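(* Let $1\le n<d$ be integers, let $\mathfrak{a}\in \mathrm{Mat}_{n,d-n}(\mathbb{R})$ and $\vec{a}_0\in\mathbb{R}^{d-n}$, and let $\mathcal{L}=\{(\vec{x},\vec{x}\mathfrak{a}+\vec{a}_0)\in\mathbb{R}^d : \vec{x}\in\mathbb{R}^n\}$. If $\omega(\mathfrak{a})<dn$, then $\mathcal{L}$ is of Khintchine type for divergence; that is, for every decreasing function $\psi:\mathbb{N}\to\mathbb{R}^+$ with $\sum_{q=1}^\infty \psi(q)^d=\infty$, almost every point of $\mathcal{L}$ (with respect to $n$-dimensional Lebesgue measure on $\mathcal{L}$) is $\psi$-approximable.
   Context: Here $\vec{x}\in\mathbb{R}^n$ is a row vector and $\vec{x}\mathfrak{a}$ is the usual matrix product. For $\vec{y}\in\mathbb{R}^k$, $|\vec{y}|$ is the sup norm and $\lVert \vec{y}\rVert$ is the sup-norm distance from $\vec{y}$ to the nearest point of $\mathbb{Z}^k$. A point $\vec{y}\in\mathbb{R}^d$ is $\psi$-approximable if $\lVert q\vec{y}\rVert<\psi(q)$ for infinitely many $q\in\mathbb{N}$. For $\omega>0$ and $\mathfrak{b}\in\mathrm{Mat}_{m,\ell}(\mathbb{R})$, write $\mathfrak{b}\in\mathbf{MAD}(m,\ell,\omega)$ if $\inf_{\vec{j}\in\mathbb{Z}^\ell\setminus\{\vec 0\}} |\vec{j}|^{\omega}\prod_{u=1}^m\lVert \vec{j}\cdot \mathrm{row}_u(\mathfrak{b})\rVert>0$. The multiplicative Diophantine exponent is $\omega(\mathfrak{b})=\inf\{\omega\in\mathbb{R}:\mathfrak{b}\in\mathbf{MAD}(m,\ell,\omega)\}$,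 with $\omega(\mathfrak{b})=\infty$ if $\mathfrak{b}$ lies in no such set. (For $\mathfrak{a}\in\mathrm{Mat}_{n,d-n}$ the rows lie in $\mathbb{R}^{d-n}$ and $\vec{j}$ ranges over $\mathbb{Z}^{d-n}\setminus\{\vec 0\}$.) *)

(* Defs.v *)
From HB Require Import structures.
From mathcomp Require Import all_boot all_order all_algebra.
From mathcomp Require Import all_classical all_reals all_analysis.

Set Implicit Arguments.
Unset Strict Implicit.
Unset Printing Implicit Defensive.

Import Order.TTheory GRing.Theory Num.Theory.
Import numFieldNormedType.Exports.

Local Open Scope classical_set_scope.
Local Open Scope ring_scope.

Section lebesgue_measure_n.
Context {R : realType}.
Local Open Scope ereal_scope.

Definition cons_pair n (p : measurableTypeR R * n.-tuple (measurableTypeR R)) :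
    n.+1.-tuple (measurableTypeR R) :=
  [tuple of p.1 :: p.2].

(* n-dimensional Lebesgue measure, on the product sigma-algebra, as the n-fold
   product of the one-dimensional one. *)
Fixpoint lebesgue_measure_n n : set (n.-tuple (measurableTypeR R)) -> \bar R :=
  match n with
  | 0%N => \d_ [tuple]
  | n'.+1 => pushforward (lebesgue_measure \x @lebesgue_measure_n n')
               (@cons_pair n')
  end.

Lemma measurable_cons_pair n : measurable_fun setT (@cons_pair n).
Proof. exact: measurable_cons. Qed.

Section step.
Variables (n : nat)
  (m : {sigma_finite_measure set (n.-tuple (measurableTypeR R)) -> \bar R}).

Definition lebesgue_measure_step :=
  pushforward (lebesgue_measure \x m) (@cons_pair n).
Local Notation nu := lebesgue_measure_step.

Let nu0 : nu set0 = 0.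
Proof. exact: (@measure0 _ _ _ (lebesgue_measure \x m)). Qed.

Let nu_ge0 A : 0 <= nu A.
Proof. exact: (@measure_ge0 _ _ _ (lebesgue_measure \x m)). Qed.

Let nu_sigma_additive : semi_sigma_additive nu.
Proof.
move=> F mF tF mUF; rewrite /lebesgue_measure_step /pushforward preimage_bigcup.
apply: measure_semi_sigma_additive.
- by move=> k; rewrite -[X in measurable X]setTI; exact: measurable_cons_pair.
- apply/trivIsetP => /= i j _ _ ij; rewrite -preimage_setI.
  by move/trivIsetP : tF => /(_ _ _ _ _ ij) ->//; rewrite preimage_set0.
- rewrite -preimage_bigcup -[X in measurable X]setTI.
  exact: measurable_cons_pair.
Qed.

HB.instance Definition _ :=
  isMeasure.Build _ _ _ nu nu0 nu_ge0 nu_sigma_additive.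

Let nu_sigma_finite : sigma_finite setT nu.
Proof.
have /sigma_finiteP[F [TF ndF Foo]] := sigma_finiteT (@lebesgue_measure R).
have /sigma_finiteP[G [TG ndG Goo]] := sigma_finiteT m.
pose g (t : n.+1.-tuple (measurableTypeR R)) :
  (measurableTypeR R * n.-tuple (measurableTypeR R))%type :=
  (thead t, [tuple of behead t]).
have mg : measurable_fun setT g.
  apply: measurable_fun_pair => /=; first exact: measurable_tnth.
  exact: measurable_behead.
have gK : cancel (@cons_pair n) g.
  by case=> x t; congr (_, _); apply/val_inj.
exists (fun k => g @^-1` (F k `*` G k)).
  rewrite -preimage_bigcup; apply/esym; rewrite -subTset => t _ /=.
  have [i _ Fi] : (\bigcup_i F i) (g t).1 by rewrite -TF.
  have [j _ Gj] : (\bigcup_i G i) (g t).2 by rewrite -TG.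
  exists (maxn i j) => //; split.
    by move: Fi; apply/subsetPset/ndF/leq_maxl.
  by move: Gj; apply/subsetPset/ndG/leq_maxr.
move=> k; have [mF Fk] := Foo k; have [mG Gk] := Goo k; split.
  by rewrite -[X in measurable X]setTI; apply: mg => //; exact: measurableX.
rewrite /lebesgue_measure_step /pushforward -comp_preimage.
rewrite (_ : g \o _ = id); last first.
  by apply/funext => x /=; exact: gK.
by rewrite preimage_id product_measure1E// lte_mul_pinfty// ge0_fin_numE.
Qed.

HB.instance Definition _ := Measure_isSigmaFinite.Build _ _ _ nu nu_sigma_finite.

End step.

Lemma lebesgue_measure_n_sigma_finite n :
  {m : {sigma_finite_measure set (n.-tuple (measurableTypeR R)) -> \bar R} |
    @lebesgue_measure_n n = m :> (_ -> _)}.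
Proof.
elim: n => [|n [m mE]] /=.
  by exists (\d_ [tuple] : {sigma_finite_measure set _ -> \bar R}).
by exists (lebesgue_measure_step m); rewrite mE.
Qed.

Section instances.
Variable n : nat.
Let mu : set (n.-tuple (measurableTypeR R)) -> \bar R := @lebesgue_measure_n n.

Let mu0 : mu set0 = 0.
Proof.
by rewrite /mu; have [m ->] := lebesgue_measure_n_sigma_finite n; exact: measure0.
Qed.

Let mu_ge0 A : 0 <= mu A.
Proof.
by rewrite /mu; have [m ->] := lebesgue_measure_n_sigma_finite n.
Qed.

Let mu_sigma_additive : semi_sigma_additive mu.
Proof.
rewrite /mu; have [m ->] := lebesgue_measure_n_sigma_finite n.
exact: measure_semi_sigma_additive.
Qed.

Let mu_sigma_finite : sigma_finite setT mu.
Proof.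
rewrite /mu; have [m ->] := lebesgue_measure_n_sigma_finite n.
exact: sigma_finiteT.
Qed.

HB.instance Definition _ := isMeasure.Build _ _ _ (@lebesgue_measure_n n)
  mu0 mu_ge0 mu_sigma_additive.
HB.instance Definition _ := Measure_isSigmaFinite.Build _ _ _
  (@lebesgue_measure_n n) mu_sigma_finite.

End instances.

Lemma lebesgue_measure_n_box n (B : 'I_n -> set (measurableTypeR R)) :
  (forall i, measurable (B i)) ->
  @lebesgue_measure_n n [set t | forall i, B i (tnth t i)] =
  \prod_(i < n) lebesgue_measure (B i).
Proof.
elim: n B => [|n IHn] B mB.
  by rewrite big_ord0 /= diracE mem_set// => -[].
rewrite big_ord_recl -IHn//=.
have [m ->] := lebesgue_measure_n_sigma_finite n.
rewrite /pushforward -product_measure1E//; last first.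
  rewrite [X in measurable X](_ : _ =
      \bigcap_(i in [set: 'I_n]) ((@tnth _ _ ^~ i) @^-1` B (lift ord0 i))).
    apply: fin_bigcap_measurable => // i _.
    by rewrite -[X in measurable X]setTI; exact: measurable_tnth.
  by apply/seteqP; split=> [t h i _|t h i]; [exact: h|exact: (h i)].
congr (_ _); apply/seteqP; split=> [[x t]/= h|[x t]/= [h0 h] i].
  by split=> [|i]; [exact: (h ord0)|have := h (lift ord0 i); rewrite tnthS].
by case: (unliftP ord0 i) => [j|] ->; [rewrite tnthS; exact: h|exact: h0].
Qed.

End lebesgue_measure_n.

Section approximation.
Context {R : realType}.

(* `|.| on row vectors is the sup norm; the infimum is attained, so this is the
   distance to a nearest integer point. *)
Definition dist_int k (y : 'rV[R]_k) : R :=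
  inf [set `|y - map_mx intr z| | z in [set: 'rV[int]_k]].

Definition approximable d (psi : nat -> R) (y : 'rV[R]_d) : Prop :=
  infinite_set [set q : nat | (0 < q)%N /\ dist_int (q%:R *: y) < psi q].

(* The 1 x 1 matrix j *m (row u b)^T is the dot product j . row_u(b). *)
Definition mult_form m l (w : R) (b : 'M[R]_(m, l)) (j : 'rV[int]_l) : R :=
  `|map_mx intr j : 'rV[R]_l| `^ w *
  \prod_(u < m) dist_int (map_mx intr j *m (row u b)^T).

Definition MAD m l (w : R) (b : 'M[R]_(m, l)) : Prop :=
  (0 < ereal_inf [set (mult_form w b j)%:E | j in [set j | j != 0%R]])%E.

Definition mult_exponent m l (b : 'M[R]_(m, l)) : \bar R :=
  ereal_inf [set w%:E | w in [set w : R | 0 < w /\ MAD w b]].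

End approximation.

Section affine_subspace.
Context {R : realType} {n d : nat} (le_nd : (n <= d)%N).
Variables (a : 'M[R]_(n, d - n)) (a0 : 'rV[R]_(d - n)).

Definition graph_point (x : 'rV[R]_n) : 'rV[R]_d :=
  castmx (erefl, subnKC le_nd) (row_mx x (x *m a + a0)).

Definition graph_subspace : set 'rV[R]_d := range graph_point.

(* n-dimensional Lebesgue measure on the graph is a constant positive multiple
   of the image of Lebesgue measure on R^n under graph_point, so both have the
   same null sets. *)
Definition graph_negligible (A : set 'rV[R]_d) : Prop :=
  (@lebesgue_measure_n R n).-negligible
    [set t | A (graph_point (\row_i tnth t i))].

(* psi is a function on the positive integers: psi 0 is unconstrained and plays
   no role.  Decreasing is meant in the weak sense. *)
Definition khintchine_type_divergence : Prop :=
  forall psi : nat -> R,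
    (forall q, (0 < q)%N -> 0 < psi q) ->
    (forall p q, (0 < p)%N -> (p <= q)%N -> psi q <= psi p) ->
    (\sum_(1 <= q <oo) (psi q ^+ d)%R%:E = +oo)%E ->
    graph_negligible (graph_subspace `\` [set y | approximable psi y]).

End affine_subspace.

(* Main.v *)
Require Import Defs.
From mathcomp Require Import all_boot all_order all_algebra.
From mathcomp Require Import all_classical all_reals all_analysis.
From mathcomp Require Import complex zify ring lra.
Set Implicit Arguments.
Unset Strict Implicit.
Unset Printing Implicit Defensive.
Set Bullet Behavior "Strict Subproofs".
Import Order.TTheory GRing.Theory Num.Theory.
Import numFieldNormedType.Exports.
Local Open Scope classical_set_scope.
Local Open Scope ring_scope.

(* By the exponent hypothesis there is [tau < d] such that every nonzero integer
   vector [j] satisfies [max_u ||j . row_u(a)|| >= c |j|^(-tau)].  Estimating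
   exponential sums with the Fejer kernel, this bounds the number of numerators
   [p] in a box with [p a + q a0] close to an integer point by the expected order
   of magnitude, as long as the closeness is at least [q^(-theta)] for some
   [theta < 1/tau], where [theta > 1/d].  By Dirichlet's pigeonhole every [x] has
   a rational approximation [p/q], [q <= Q], with [p a + q a0] close to an integer
   point, and the count shows that for most [x] on a grid [q] has size about [Q].
   This gives a well-spaced family of rational points at each scale [Q = 2^k].  A
   second moment argument over the scales shows that the [psi]-boxes around these
   points fill a fixed proportion of every dyadic cell, however large their
   denominators are required to be; hence they cover almost every point. *)


(** A product condition of exponent [w < dn] leaves the maximum over [u] with exponent [w/n < d]. So
    some [theta > 1/d] satisfies [theta w < n] and, as [d - n < d], also [theta (d - n) < 1]. The
    three inequalities do different work. [theta d > 1] lets the scales with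
    [psi(2^k) < 2^(-k theta)] be dropped. [theta w < n] is the range in which the exponential sums
    give the expected count. [theta (d - n) < 1] disposes of small denominators: for [q] far below
    [Q] the required closeness may be finer than [q^(-theta)], so only the count for [q^(-theta)] is
    available; summed over [q <= Q/E] it spoils a share of the grid of order
    [E^(theta (d - n) - 1)], small for a constant [E]. The proportion filled in a cell must not
    depend on the size of the cell. All constants are therefore fixed before its side, which only
    delays the first usable scale. A proportion below 1 then suffices without a zero-one law,
    because a measurable set is, up to small measure, a union of dyadic cells. *)

(** * Trigonometric sums and the Fejer kernel *)

Section exponential_sums.
Context {R : realType}.
Implicit Types (x t : R).

Lemma cosD_intpi x (k : int) : cos (x + 2 * pi * k%:~R) = cos x.
Proof.
have cosN (y : R) (n : nat) : cos (y + 2 * pi * n%:R) = cos y.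
  have -> : 2 * pi * n%:R = (pi *+ 2) *+ n :> R.
    by rewrite -mulr_natr -mulr_natr; ring.
  exact: (periodicn (@cosD2pi R)).
case: (intP k) => [|n|n]; first by rewrite mulr0 addr0.
- exact: (cosN x n.+1).
- rewrite -[LHS](cosN _ n.+1); congr cos.
  by rewrite rmorphN /= -pmulrn; ring.
Qed.

Lemma cos_ge_half x : `|x| <= pi / 4 -> 1 / 2 <= cos x.
Proof.
rewrite ler_norml => /andP[x1 x2]; have pi0 := pi_gt0 R.
have c0 : 0 <= cos x by apply: cos_ge0_pihalf; apply/andP; split; lra.
have : 0 <= cos (x *+ 2).
  by apply: cos_ge0_pihalf; rewrite -mulr_natr; apply/andP; split; lra.
rewrite cos_mulr2n mulr2n; set c := cos x in c0 *; nra.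
Qed.

(** Weaker than Jordan's inequality, which gives [2 t]. Up to [pi / 4] the mean value theorem
    applies with [cos >= 1/2] and [pi >= 2]; beyond, [cos (2 pi t) <= 0] gives [sin^2 >= 1/2], while
    [t <= 1/2]. *)
Lemma sin_pi_ge t : 0 <= t <= 1 / 2 -> t <= sin (pi * t).
Proof.
move=> /andP[t0 t1]; have pi0 := pi_gt0 R; have pi2 := pi_ge2 R.
have [tl|tl] := leP (pi * t) (pi / 4).
- have pt0 : 0 <= pi * t by nra.
  have [c] := MVT_segment pt0 (fun y _ => is_derive_sin y)
    (continuous_subspaceT (@continuous_sin R)).
  rewrite in_itv /= => /andP[c0 c1]; rewrite sin0 !subr0 => ->.
  have : 1 / 2 <= cos c by apply: cos_ge_half; rewrite ger0_norm; lra.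
  set u := cos c; move=> u1; nra.
- have s0 : 0 <= sin (pi * t) by apply: sin_ge0_pi; apply/andP; split; nra.
  have : cos ((pi * t) *+ 2) <= 0.
    have -> : (pi * t) *+ 2 = (pi * t *+ 2 - pi / 2) + pi / 2 by ring.
    rewrite cosDpihalf oppr_le0; apply: sin_ge0_pi.
    by rewrite mulr2n; apply/andP; split; nra.
  rewrite cos_mulr2n mulr2n; have := cos2Dsin2 (pi * t).
  set s := sin _ in s0 *; set c := cos _; nra.
Qed.

(** Real part of the expansion of the squared modulus of the sum of [exp(i f v)]; [sum_sinB] is the
    imaginary part, which vanishes by symmetry. *)
Lemma sum_cosB (X : finType) (f : X -> R) :
  \sum_(v : X * X) cos (f v.1 - f v.2) =
  (\sum_v cos (f v)) ^+ 2 + (\sum_v sin (f v)) ^+ 2.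
Proof.
rewrite -(pair_bigA _ (fun v w => cos (f v - f w))) /=.
rewrite !expr2 !big_distrlr /= -big_split /=; apply: eq_bigr => v _.
by rewrite -big_split /=; apply: eq_bigr => w _; rewrite cosB.
Qed.

Lemma sum_sinB (X : finType) (f : X -> R) :
  \sum_(v : X * X) sin (f v.1 - f v.2) = 0.
Proof.
rewrite -(pair_bigA _ (fun v w => sin (f v - f w))) /=.
rewrite (eq_bigr (fun v => \sum_w (sin (f v) * cos (f w)) -
   \sum_w cos (f v) * sin (f w))); last first.
  by move=> v _; rewrite -sumrB; apply: eq_bigr => w _; rewrite sinB.
by rewrite sumrB -!big_distrlr /= mulrC subrr.
Qed.

(* The sum of exp(i(b + sum_u x_u)) factors, and the hypothesis makes each
   factor real. *)
Lemma sum_cos_factor (n : nat) (X : finType) (x : 'I_n -> X -> R) (b : R) :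
  (forall u, \sum_v sin (x u v) = 0) ->
  \sum_(f : {ffun 'I_n -> X}) cos (b + \sum_u x u (f u)) =
  cos b * \prod_u \sum_v cos (x u v).
Proof.
move=> s0; pose e (t : R) : R[i] := (cos t +i* sin t)%C.
have eD s t : e (s + t) = e s * e t.
  by rewrite /e cosD sinD; apply/eqP; rewrite eq_complex /= eqxx addrC eqxx.
have e0 : e 0 = 1 by rewrite /e cos0 sin0.
have eS (J : finType) (F : J -> R) : e (\sum_j F j) = \prod_j e (F j).
  by rewrite (big_morph e eD e0).
have es (J : finType) (F : J -> R) :
    \sum_j e (F j) = ((\sum_j cos (F j)) +i* (\sum_j sin (F j)))%C.
  by elim/big_rec3: _ => //= j y1 y2 y3 _ ->.
have : \sum_(f : {ffun 'I_n -> X}) e (b + \sum_u x u (f u)) =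
  e b * \prod_u \sum_v e (x u v).
  rewrite bigA_distr_bigA big_distrr /=; apply: eq_bigr => f _.
  by rewrite eD eS.
under [in RHS]eq_bigr do rewrite es s0.
have -> : \prod_u ((\sum_v cos (x u v)) +i* 0)%C =
    ((\prod_u \sum_v cos (x u v)) +i* 0)%C :> R[i].
  elim/big_rec2: _ => //= u y1 y2 _ ->.
  by apply/eqP; rewrite eq_complex /= !mulr0 !mul0r subr0 addr0 !eqxx.
rewrite es => /eqP; rewrite eq_complex /= => /andP[/eqP -> _].
by rewrite mulr0 subr0.
Qed.

(** The squared modulus of the sum of [exp(2 pi i p t)] over [p < N], that is [N] times the
    normalized Fejer kernel. *)
Definition fejer (N : nat) t :=
  (\sum_(p < N) cos (2 * pi * (p%:R * t))) ^+ 2 +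
  (\sum_(p < N) sin (2 * pi * (p%:R * t))) ^+ 2.

Lemma fejer_ge0 N t : 0 <= fejer N t.
Proof. by rewrite addr_ge0 // sqr_ge0. Qed.

Lemma fejer_le N t : fejer N t <= N%:R ^+ 2.
Proof.
rewrite /fejer -sum_cosB -natrX.
apply: (le_trans (ler_sum _ (fun v _ => cos_le1 _))).
by rewrite sumr_const card_prod card_ord.
Qed.

(** By the geometric series the left-hand side equals [sin(pi N t)^2]; [ec] and [es] are the real
    and imaginary parts of that series, telescoped after multiplication by [2 sin(pi t)]. *)
Lemma fejer_sin N t : fejer N t * sin (pi * t) ^+ 2 <= 1.
Proof.
have ec : 2 * sin (pi * t) * \sum_(p < N) cos (2 * pi * (p%:R * t)) =
    sin (2 * pi * (N%:R * t) - pi * t) + sin (pi * t).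
  elim: N => [|N IH]; first by rewrite big_ord0 !mul0r !mulr0 sub0r sinN addNr.
  rewrite big_ord_recr /= mulrDr IH.
  have -> : 2 * pi * (N.+1%:R * t) - pi * t = 2 * pi * (N%:R * t) + pi * t.
    by rewrite -natr1; ring.
  by rewrite sinB sinD; ring.
have es : 2 * sin (pi * t) * \sum_(p < N) sin (2 * pi * (p%:R * t)) =
    cos (pi * t) - cos (2 * pi * (N%:R * t) - pi * t).
  elim: N {ec} => [|N IH].
    by rewrite big_ord0 !mul0r !mulr0 sub0r cosN subrr.
  rewrite big_ord_recr /= mulrDr IH.
  have -> : 2 * pi * (N.+1%:R * t) - pi * t = 2 * pi * (N%:R * t) + pi * t.
    by rewrite -natr1; ring.
  by rewrite cosB cosD; ring.
have := cos_geN1 (2 * pi * (N%:R * t) - pi * t + pi * t).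
rewrite cosD; have := cos2Dsin2 (pi * t).
have := cos2Dsin2 (2 * pi * (N%:R * t) - pi * t).
move: ec es; rewrite /fejer.
set C := \sum_(p < N) _; set S := \sum_(p < N) _.
set a := sin (pi * t); set b := cos (pi * t).
set A := sin (_ - _); set B := cos (_ - _) => ec es h1 h2 h3.
have : (2 * a * C) ^+ 2 + (2 * a * S) ^+ 2 <= 4 by rewrite ec es; nra.
nra.
Qed.

Lemma fejer_shift N t (k : int) : fejer N (t + k%:~R) = fejer N t.
Proof.
rewrite /fejer -!sum_cosB; apply: eq_bigr => -[p q] _ /=.
rewrite -[RHS](cosD_intpi _ ((p%:Z - q%:Z) * k)); congr cos.
by rewrite rmorphM rmorphB /=; ring.
Qed.

(** [fejer_sin] and [sin_pi_ge] bound the kernel by the inverse square of the distance to the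
    nearest integer; the two terms serve [t] near 0 and [t] near 1. The factor 4 pays for replacing
    [c] by [c + 1], so that the end cells are covered by the trivial bound [N^2]. *)
Lemma fejer_cell N t (c : nat) : (c < N)%N ->
  c%:R <= N%:R * t -> N%:R * t < c.+1%:R ->
  fejer N t <= 4 * N%:R ^+ 2 * (c.+1%:R ^- 2 + (N - c)%:R ^- 2).
Proof.
move=> cN h1 h2; have G0 := fejer_ge0 N t; have G1 := fejer_le N t.
have N0 : 0 < N%:R :> R by rewrite ltr0n (leq_ltn_trans _ cN).
have t0 : 0 <= t by rewrite -(pmulr_rge0 _ N0) (le_trans _ h1).
have t1 : t < 1.
  by rewrite -(ltr_pM2l N0) mulr1 (lt_le_trans h2) // ler_nat.
(* Here [w] is the distance to the chosen endpoint of [[0, 1]], and [d] the rank of the cell counted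
   from that endpoint, starting at 1. *)
have key (d : nat) (w : R) : (0 < d)%N -> 0 <= w -> d.-1%:R <= N%:R * w ->
    fejer N t * w ^+ 2 <= 1 -> fejer N t <= 4 * N%:R ^+ 2 * d%:R ^- 2.
  move=> d0 w0 hd hw.
  have dp : 0 < d%:R ^+ 2 :> R by rewrite exprn_gt0 // ltr0n.
  rewrite ler_pdivlMr //; case: d d0 hd dp => // -[_ _ dp|d _ hd dp] /=.
    by rewrite expr1n mulr1; nra.
  have d2 : d.+2%:R <= 2 * (N%:R * w) :> R.
    apply: (@le_trans _ _ (2 * d.+1%:R)); last by rewrite ler_pM2l.
    by rewrite -natrM ler_nat; lia.
  have : d.+2%:R ^+ 2 <= (2 * (N%:R * w)) ^+ 2.
    by rewrite ler_sqr // nnegrE ?ler0n // ?mulr_ge0 // ltW.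
  set D := d.+2%:R ^+ 2; move=> hD.
  apply: (@le_trans _ _ (fejer N t * (2 * (N%:R * w)) ^+ 2)).
    exact: ler_wpM2l.
  rewrite [leLHS](_ : _ = 4 * N%:R ^+ 2 * (fejer N t * w ^+ 2)); last by ring.
  by apply: ler_piMr => //; apply: mulr_ge0 => //; exact: sqr_ge0.
rewrite mulrDr; have := fejer_sin N t; set s := sin _ => hs.
have q0 (k : nat) : 0 <= 4 * N%:R ^+ 2 * k%:R ^- 2 :> R.
  by rewrite mulr_ge0 ?mulr_ge0 ?sqr_ge0 // invr_ge0 exprn_ge0.
have [tl|tl] := leP t (1 / 2).
- apply: ler_wpDr; first exact: q0.
  apply: (key _ t) => //; apply: le_trans hs; apply: ler_wpM2l => //.
  have ts : t <= s by apply: sin_pi_ge; rewrite t0.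
  by rewrite ler_sqr // nnegrE // (le_trans t0).
- apply: ler_wpDl; first exact: q0.
  apply: (key _ (1 - t)); [by rewrite subn_gt0|by rewrite subr_ge0 ltW| |].
    rewrite mulrBr mulr1 -subnS natrB // lerD2l lerN2; exact: ltW.
  apply: le_trans hs; apply: ler_wpM2l => //.
  have ts : 1 - t <= s.
    rewrite /s (_ : pi * t = - (pi * (1 - t) - pi)); last by ring.
    rewrite sinN sinB cospi sinpi mulr0 subr0 mulrN1 opprK.
    by apply: sin_pi_ge; apply/andP; split; lra.
  have t2 : 0 <= 1 - t by rewrite subr_ge0 ltW.
  by rewrite ler_sqr // nnegrE // (le_trans t2).
Qed.

Lemma sum_inv_sqr_le N : \sum_(c < N) (c.+1%:R ^- 2 : R) <= 2.
Proof.
case: N => [|N]; first by rewrite big_ord0.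
suff : \sum_(c < N.+1) (c.+1%:R ^- 2 : R) <= 2 - N.+1%:R^-1.
  by move=> h; apply: le_trans h _; rewrite lerBlDr lerDl invr_ge0.
elim: N => [|N IH]; first by rewrite big_ord1 expr1n invr1; lra.
rewrite big_ord_recr /=; apply: (le_trans (lerD IH (lexx _))).
rewrite -addrA lerD2l -subr_ge0 -[N.+2%:R]natr1.
move: (N.+1%:R : R) (ltr0Sn R N) => x x0.
rewrite [leRHS](_ : _ = x^-1 * (x + 1) ^- 2); last first.
  by field; rewrite !gt_eqF //; lra.
by rewrite mulr_ge0 ?invr_ge0 ?exprn_ge0 //; lra.
Qed.

End exponential_sums.

(** * Fractional parts and cells of the torus *)

Section fractional_part.
Context {R : realType}.
Implicit Types t : R.

Definition frac t : R := t - (Num.floor t)%:~R.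

Lemma frac_itv t : 0 <= frac t < 1.
Proof.
rewrite /frac; have /andP[h1 h2] := floor_itv t.
by rewrite subr_ge0 h1 /= ltrBlDl -intrD1.
Qed.

Lemma frac_cell_lt (N : nat) (N0 : (0 < N)%N) t :
  (Num.truncn (N%:R * frac t) < N)%N.
Proof.
have /andP[h1 h2] := frac_itv t; rewrite truncn_lt_nat ?mulr_ge0 //.
by rewrite -[ltRHS]mulr1 ltr_pM2l // ltr0n.
Qed.

Lemma frac_cell_itv (N : nat) t :
  (Num.truncn (N%:R * frac t))%:R <= N%:R * frac t <
  (Num.truncn (N%:R * frac t)).+1%:R.
Proof. by apply: truncn_itv; rewrite mulr_ge0 //; case/andP: (frac_itv t). Qed.

Lemma frac_cell_eq (N : nat) s t :
  Num.truncn (N%:R * frac s) = Num.truncn (N%:R * frac t) ->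
  N%:R * `|frac s - frac t| < 1.
Proof.
move=> e; have := frac_cell_itv N s; have := frac_cell_itv N t.
rewrite {}e -natr1; set c := _%:R; move=> /andP[h1 h2] /andP[h3 h4].
rewrite -[X in X * _]ger0_norm // -normrM mulrBr ltr_norml.
by apply/andP; split; lra.
Qed.

End fractional_part.

(** * Counting numerators by exponential sums *)

(** Modulo 1, the [J^m] vectors with coordinates [sum_i j_i a_(u,i)], [0 <= j_i < J], are pairwise
    at sup distance at least [1/(3P)]: the vectors quantified here are the differences of two such
    [j]. The number [3P] is the side of the widened numerator box used in the count. *)
Definition separated {R : realType} n m (a : 'M[R]_(n, m)) (P J : nat) :=
  forall j : 'I_m -> int, (exists i, j i != 0) -> (forall i, `|j i| < J%:Z) ->
  forall z : 'I_n -> int,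
  exists u, 1 <= (3 * P)%:R * `|\sum_i (j i)%:~R * a u i - (z u)%:~R|.

Section lattice_count.
Context {R : realType} (n m : nat) (a : 'M[R]_(n, m)) (b : 'I_m -> R) (P J : nat).
Hypotheses (P0 : (0 < P)%N) (J0 : (0 < J)%N).

Hypothesis sep : separated a P J.

Let N := (3 * P)%N.

Let shift_lt (p : 'I_P) (q : 'I_(2 * P)) : (p + q < N)%N.
Proof. by rewrite /N; have := ltn_ord p; have := ltn_ord q; lia. Qed.

Let shift_lt2 (q : 'I_(2 * P)) : (q < N)%N.
Proof. by rewrite /N; have := ltn_ord q; lia. Qed.

Let pt (v : 'I_N * 'I_N) : R := v.1%:R - v.2%:R.

Let form (j : {ffun 'I_m -> 'I_J}) (f : {ffun 'I_n -> 'I_N * 'I_N}) : R :=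
  \sum_i (j i)%:R * (\sum_u pt (f u) * a u i + b i).

Let theta (j : {ffun 'I_m -> 'I_J} * {ffun 'I_m -> 'I_J}) u : R :=
  \sum_i ((j.1 i)%:R - (j.2 i)%:R) * a u i.

(** Squared modulus of the sum over [j] of [exp(2 pi i form j f)]. Numerators enter as differences
    of pairs because the multiplicities of these differences are the coefficients of the Fejer
    kernel. *)
Let weight (f : {ffun 'I_n -> 'I_N * 'I_N}) : R :=
  \sum_(j : {ffun 'I_m -> 'I_J} * {ffun 'I_m -> 'I_J})
    cos (2 * pi * form j.1 f - 2 * pi * form j.2 f).

Let sum_weight_eq : \sum_f weight f =
  \sum_(j : {ffun 'I_m -> 'I_J} * {ffun 'I_m -> 'I_J})
    cos (2 * pi * \sum_i ((j.1 i)%:R - (j.2 i)%:R) * b i) *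
    \prod_u fejer N (theta j u).
Proof.
rewrite exchange_big /=; apply: eq_bigr => j _.
pose x u (v : 'I_N * 'I_N) :=
  2 * pi * (v.1%:R * theta j u) - 2 * pi * (v.2%:R * theta j u).
have -> : \prod_u fejer N (theta j u) = \prod_u \sum_v cos (x u v).
  apply: eq_bigr => u _.
  by rewrite /fejer -(sum_cosB (fun p : 'I_N => 2 * pi * (p%:R * theta j u))).
rewrite -(@sum_cos_factor R n _ x); last first.
  move=> u; exact: (sum_sinB (fun p : 'I_N => 2 * pi * (p%:R * theta j u))).
apply: eq_bigr => f _; congr cos.
rewrite -mulrBr (_ : \sum_u x u (f u) = 2 * pi * \sum_u pt (f u) * theta j u).
  rewrite -mulrDr; congr (_ * _); rewrite /form -sumrB.
  under [\sum_u pt _ * _]eq_bigr => u _ do rewrite /theta mulr_sumr.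
  rewrite exchange_big /= -big_split /=; apply: eq_bigr => i _.
  rewrite -mulrBl mulrDr addrC; congr (_ + _); rewrite mulr_sumr.
  by apply: eq_bigr => u _; ring.
by rewrite mulr_sumr; apply: eq_bigr => u _; rewrite /x /pt; ring.
Qed.

Let N0 : (0 < N)%N. Proof. by rewrite /N; lia. Qed.

Let cell j1 (j2 : {ffun 'I_m -> 'I_J}) : {ffun 'I_n -> 'I_N} :=
  [ffun u => Ordinal (frac_cell_lt N0 (theta (j1, j2) u))].

(** Two vectors in the same cell would differ modulo 1 by less than [1/N] in every row, against
    [sep]; the integers supplied to it are the differences of the floors. *)
Let cell_inj j1 : injective (cell j1).
Proof.
move=> j j' /ffunP jj'; apply: contrapT => neq.
have hex : exists i, (j i)%:Z - (j' i)%:Z != 0.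
  apply: contrapT => h; apply: neq; apply/ffunP => i; apply/val_inj => /=.
  apply/eqP/negPn/negP => ij; apply: h; exists i.
  by rewrite subr_eq0; apply: contra ij => /eqP[->].
have hlt i : `|(j i)%:Z - (j' i)%:Z| < J%:Z.
  by have := ltn_ord (j i); have := ltn_ord (j' i); lia.
have [u] := sep hex hlt
  (fun u => Num.floor (theta (j1, j') u) - Num.floor (theta (j1, j) u)).
apply/negP; rewrite -ltNge; have /(congr1 val) := jj' u; rewrite !ffunE /= => e.
have -> : \sum_i ((j i)%:Z - (j' i)%:Z)%:~R * a u i =
    theta (j1, j') u - theta (j1, j) u.
  rewrite /theta /= -sumrB; apply: eq_bigr => i _.
  by rewrite rmorphB /=; ring.
rewrite (_ : _ - _ = frac (theta (j1, j') u) - frac (theta (j1, j) u));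
  last by rewrite /frac rmorphB /=; ring.
by rewrite distrC; exact: frac_cell_eq.
Qed.

(** As distinct [j2] occupy distinct cells, the sum over [j2] is at most the sum over all cells, and
    the latter factors over the rows. Each factor is a sum of inverse squares, of size [N^2]
    whatever [J] is. *)
Let sum_fejer_le j1 :
  \sum_j2 \prod_u fejer N (theta (j1, j2) u) <= (16 * N%:R ^+ 2) ^+ n.
Proof.
pose F (c : 'I_N) : R := 4 * N%:R ^+ 2 * (c.+1%:R ^- 2 + (N - c)%:R ^- 2).
have F0 c : 0 <= F c.
  by rewrite mulr_ge0 ?mulr_ge0 ?sqr_ge0 // addr_ge0 // invr_ge0 exprn_ge0.
have -> : (16 * N%:R ^+ 2) ^+ n = \prod_(u < n) (16 * N%:R ^+ 2) :> R.
  by rewrite prodr_const card_ord.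
apply: (@le_trans _ _ (\prod_(u < n) \sum_c F c)).
  rewrite bigA_distr_bigA /=.
  apply: (@le_trans _ _ (\sum_j2 \prod_u F (cell j1 j2 u))).
    apply: ler_sum => j2 _; apply: ler_prod => u _; rewrite fejer_ge0 /=.
    have /andP[h1 h2] := frac_cell_itv N (theta (j1, j2) u).
    rewrite -(subrK (Num.floor (theta (j1, j2) u))%:~R (theta (j1, j2) u)).
    by rewrite fejer_shift ffunE; exact: fejer_cell.
  rewrite -(big_imset (fun c : {ffun 'I_n -> 'I_N} => \prod_u F (c u)))/=; last first.
    by move=> x y _ _; exact: cell_inj.
  rewrite [leRHS](bigID (mem [set cell j1 j2 | j2 in xpredT]%SET))/=.
  apply: ler_wpDr; first by apply: sumr_ge0 => c _; apply: prodr_ge0 => u _.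
  exact: lexx.
apply: ler_prod => u _; rewrite sumr_ge0 //= /F -mulr_sumr big_split /=.
rewrite [X in _ + X](reindex_inj rev_ord_inj) /=.
under [X in _ + X]eq_bigr => c _ do rewrite subKn //.
rewrite (_ : 16 * N%:R ^+ 2 = 4 * N%:R ^+ 2 * (2 + 2)); last by ring.
by apply: ler_wpM2l; rewrite ?mulr_ge0 ?sqr_ge0 // lerD // sum_inv_sqr_le.
Qed.

Let sum_weight_le :
  \sum_f weight f <= J%:R ^+ m * (16 * N%:R ^+ 2) ^+ n.
Proof.
rewrite sum_weight_eq.
rewrite -(pair_bigA _ (fun j1 j2 : {ffun 'I_m -> 'I_J} => cos (2 * pi * \sum_i ((j1 i)%:R -
   (j2 i)%:R) * b i) * \prod_u fejer N (theta (j1, j2) u))) /=.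
have -> : J%:R ^+ m = \sum_(j : {ffun 'I_m -> 'I_J}) (1 : R).
  by rewrite sumr_const card_ffun !card_ord natrX.
rewrite mulr_suml; apply: ler_sum => j1 _; rewrite mul1r.
apply: le_trans (sum_fejer_le j1); apply: ler_sum => j2 _.
by apply: ler_piMl (cos_le1 _); apply: prodr_ge0 => u _; exact: fejer_ge0.
Qed.

(** A large sieve argument. On [A] every phase is within [1/8] of an integer, so the weight there is
    at least [J^(2m) / 4], and each [p] in [A] is the difference of [(2P)^n] pairs [(p + q, q)] with
    entries below [3P]. Comparison with the total weight, at most [J^m (144 P^2)^n], leaves the
    constant [4 * 72^n]. *)
Lemma lattice_count (A : {set {ffun 'I_n -> 'I_P}}) :
  (forall p, p \in A -> exists z : 'I_m -> int, forall i,
    (8 * m * J)%:R * `|\sum_u (p u)%:R * a u i + b i - (z i)%:~R| <= 1) ->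
  #|A|%:R * J%:R ^+ m <= 4 * 72 ^+ n * P%:R ^+ n :> R.
Proof.
move=> hA.
pose g (x : {ffun 'I_n -> 'I_P} * {ffun 'I_n -> 'I_(2 * P)}) :
    {ffun 'I_n -> 'I_N * 'I_N} :=
  [ffun u => (Ordinal (shift_lt (x.1 u) (x.2 u)), Ordinal (shift_lt2 (x.2 u)))].
have gI : injective g.
  move=> [x y] [x' y'] /ffunP h.
  have hy u : y u = y' u :> nat by have := h u; rewrite !ffunE /= => -[].
  have hx u : x u = x' u :> nat.
    by have := h u; rewrite !ffunE /= => -[]; rewrite hy => /addIn.
  have -> : y = y' by apply/ffunP => u; apply/val_inj/hy.
  by have -> : x = x' by apply/ffunP => u; apply/val_inj/hx.
have weightE f : weight f = (\sum_j cos (2 * pi * form j f)) ^+ 2 +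
    (\sum_j sin (2 * pi * form j f)) ^+ 2.
  exact: (sum_cosB (fun j => 2 * pi * form j f)).
have w0 f : 0 <= weight f by rewrite weightE addr_ge0 // sqr_ge0.
have wA p q : p \in A -> (J%:R ^+ m) ^+ 2 / 4 <= weight (g (p, q)).
  move=> pA; rewrite weightE.
  have cos_half (j : {ffun 'I_m -> 'I_J}) : 1 / 2 <= cos (2 * pi * form j (g (p, q))).
    have [z hz] := hA p pA.
    (* Subtracting the integer [sum_i j_i z_i] from the form does not change the cosine and leaves
       [m] terms of size at most [1/(8 m)] each. *)
    rewrite -(cosD_intpi _ (- \sum_i (j i)%:Z * z i)) -mulrDr.
    apply: cos_ge_half; rewrite !normrM (ger0_norm (pi_ge0 R)) ger0_norm //.
    suff : `|form j (g (p, q)) + (- \sum_i (j i)%:Z * z i)%:~R| <= 1 / 8.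
      by have := pi_gt0 R; set y := `|_|; nra.
    rewrite rmorphN rmorph_sum /= -sumrB.
    apply: le_trans (ler_norm_sum _ _ _) _.
    apply: (@le_trans _ _ (\sum_(i < m) (8 * m%:R)^-1)); last first.
      rewrite sumr_const card_ord; have [->|m0] := posnP m; first by rewrite mulr0n; lra.
      have mR : m%:R != 0 :> R by rewrite pnatr_eq0 -lt0n.
      by rewrite -[leLHS]mulr_natr le_eqVlt; apply/orP; left; apply/eqP; field.
    apply: ler_sum => i _; have m0 : (0 < m)%N by apply: leq_ltn_trans (ltn_ord i).
    have -> : (j i)%:R * (\sum_u pt (g (p, q) u) * a u i + b i) -
        ((j i)%:Z * z i)%:~R =
        (j i)%:R * (\sum_u (p u)%:R * a u i + b i - (z i)%:~R).
      rewrite rmorphM /= -mulrBr; congr (_ * (_ + _ - _)); apply: eq_bigr => u _.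
      by rewrite /pt ffunE /= natrD addrK.
    rewrite normrM ger0_norm //; have := hz i.
    set y := `|_|; rewrite !natrM => hy; have y0 : 0 <= y by exact: normr_ge0.
    have ji : (j i)%:R <= J%:R :> R by rewrite ler_nat ltnW.
    have m1 : 0 < m%:R :> R by rewrite ltr0n.
    rewrite -(ler_pM2l (_ : 0 < 8 * m%:R)) ?mulr_gt0 //.
    rewrite mulfV ?gt_eqF ?mulr_gt0 //.
    apply: le_trans hy; rewrite mulrA ler_wpM2r // [leRHS]mulrC mulrC.
    by rewrite ler_wpM2l // mulr_ge0.
  apply: ler_wpDr; first exact: sqr_ge0.
  have -> : (J%:R ^+ m) ^+ 2 / 4 =
      (\sum_(j : {ffun 'I_m -> 'I_J}) (1 / 2 : R)) ^+ 2.
    by rewrite sumr_const card_ffun !card_ord -[(1 / 2) *+ _]mulr_natr natrX; field.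
  apply: lerXn2r; rewrite ?nnegrE; first by apply: sumr_ge0 => j _; lra.
    apply: sumr_ge0 => j _; apply: le_trans (cos_half j); lra.
  by apply: ler_sum => j _; exact: cos_half.
have : #|A|%:R * ((2 * P)%:R ^+ n * ((J%:R ^+ m) ^+ 2 / 4)) <= \sum_f weight f.
  pose AT := (finset.setX A (finset.setT : {set {ffun 'I_n -> 'I_(2 * P)}})).
  apply: (@le_trans _ _ (\sum_(x in AT) weight (g x))).
    apply: (@le_trans _ _ (\sum_(x in AT) (J%:R ^+ m) ^+ 2 / 4)).
      rewrite sumr_const cardsX cardsT card_ffun !card_ord -[leRHS]mulr_natr.
      rewrite !natrM natrX natrM.
      by rewrite le_eqVlt; apply/orP; left; apply/eqP; ring.
    by apply: ler_sum => -[p q]; rewrite finset.inE /= => /andP[pA _]; exact: wA.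
  rewrite -(big_imset weight) /=; last by move=> x y _ _; exact: gI.
  rewrite [leRHS](bigID (mem [set g x | x in AT]%SET)) /=.
  by apply: ler_wpDr => //; apply: sumr_ge0 => f _; exact: w0.
move=> h; have := le_trans h sum_weight_le; rewrite /N !natrM.
have Jp : 0 < J%:R ^+ m :> R by rewrite exprn_gt0 // ltr0n.
have Pp : 0 < (2 * P%:R) ^+ n :> R by rewrite exprn_gt0 // mulr_gt0 // ltr0n.
have -> : (16 * (3 * P%:R) ^+ 2) ^+ n = (2 * P%:R) ^+ n * (72 ^+ n * P%:R ^+ n) :> R.
  by rewrite -!exprMn; congr (_ ^+ n); ring.
set x := _ ^+ m in Jp *; set y := (2 * _) ^+ n in Pp *.
set c := 72 ^+ n; set d := P%:R ^+ n; set k := #|A|%:R => h2.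
have : (x * y) * (k * x) <= (x * y) * (4 * c * d).
  by rewrite -subr_ge0; move: h2; rewrite -subr_ge0; lra.
by rewrite ler_pM2l // mulr_gt0.
Qed.


End lattice_count.

(** * Dirichlet approximation and elementary counting *)

(** Pigeonhole on the [Q + 1] multipliers [k <= Q]. The last [m] coordinates record the fractional
    parts of [floor(k x) a + k a0], not of [k x a + k a0]: the difference of two of them then
    involves exactly the integer numerators [p], and rounding costs nothing. *)
Lemma graph_dirichlet {R : realType} (n m : nat) (a : 'M[R]_(n, m))
    (a0 : 'I_m -> R) (x : 'I_n -> R) (Q M1 M2 : nat) :
  (0 < M1)%N -> (0 < M2)%N -> (M1 ^ n * M2 ^ m <= Q)%N ->
  exists (q : nat) (p : 'I_n -> int) (z : 'I_m -> int),
  [/\ (0 < q <= Q)%N, (forall u, M1%:R * `|q%:R * x u - (p u)%:~R| < 1) &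
   forall i, M2%:R * `|\sum_u (p u)%:~R * a u i + q%:R * a0 i - (z i)%:~R| < 1].
Proof.
move=> M10 M20 MQ.
pose th (k : nat) i := \sum_u (Num.floor (k%:R * x u))%:~R * a u i + k%:R * a0 i.
pose f (k : 'I_Q.+1) : {ffun 'I_n -> 'I_M1} * {ffun 'I_m -> 'I_M2} :=
  ([ffun u => Ordinal (frac_cell_lt M10 (k%:R * x u))],
   [ffun i => Ordinal (frac_cell_lt M20 (th k i))]).
have : exists k k' : 'I_Q.+1, f k = f k' /\ (k < k')%N.
  apply: contrapT => hn.
  have : injective f.
  { move=> k k' e; apply/val_inj; have [kk|kk|kk] := ltngtP k k'.
    + by exfalso; apply: hn; exists k, k'.
    + by exfalso; apply: hn; exists k', k.
    + exact: kk. }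
  move=> /leq_card; rewrite card_prod !card_ffun !card_ord => h.
  by have := leq_trans h MQ; rewrite ltnn.
case=> k [k' [[/ffunP e1 /ffunP e2] kk]].
exists (k' - k)%N, (fun u => Num.floor (k'%:R * x u) - Num.floor (k%:R * x u)),
  (fun i => Num.floor (th k' i) - Num.floor (th k i)).
split.
- by rewrite subn_gt0 kk /=; have := ltn_ord k'; lia.
- move=> u; have /(congr1 val) := e1 u; rewrite !ffunE /= => /frac_cell_eq.
  rewrite distrC /frac natrB ?rmorphB /=; last exact: ltnW.
  by congr (_ * `|_| < _); ring.
- move=> i; have /(congr1 val) := e2 i; rewrite !ffunE /= => /frac_cell_eq.
  rewrite distrC /frac natrB ?rmorphB /=; last exact: ltnW.
  congr (_ * `|_| < _); rewrite {1 3}/th.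
  under [X in _ = X + _ - _]eq_bigr => u _ do rewrite rmorphB /= mulrBl.
  by rewrite sumrB; ring.
Qed.

Lemma card_near1 {R : realType} (L : nat) (y w : R) : 0 <= w ->
  #|[set i : 'I_L | `|i%:R - y| <= w]%SET|%:R <= 2 * w + 1.
Proof.
move=> w0; set B := finset.finset _.
have w20 : 0 <= 2 * w by rewrite mulr_ge0.
have [->|[i0 Bi0]] := set_0Vmem B; first by rewrite cards0 addr_ge0.
have [i Bi imin] := @arg_minnP _ i0 (mem B) (fun i => val i) Bi0.
have hB j : j \in B -> (j - i < (Num.truncn (2 * w)).+1)%N.
  move=> Bj; rewrite ltnS truncn_ge_nat // natrB; last exact: imin.
  move: Bi Bj; rewrite !finset.inE !ler_norml => /andP[? ?] /andP[? ?]; lra.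
apply: (@le_trans _ _ (Num.truncn (2 * w)).+1%:R); last first.
  by rewrite -natr1 lerD2r; have /andP[] := truncn_itv w20.
rewrite ler_nat -[leqRHS]card_ord.
pose f (j : 'I_L) : 'I_(Num.truncn (2 * w)).+1 := inord (j - i).
rewrite -(@card_in_imset _ _ f (mem B)); first exact: max_card.
move=> j j' Bj Bj' /(congr1 val); rewrite /= !inordK ?hB // => e.
have : (i <= j)%N := imin _ Bj; have : (i <= j')%N := imin _ Bj'.
by move=> ? ?; apply/val_inj => /=; lia.
Qed.

Lemma card_near {R : realType} (n L : nat) (y : 'I_n -> R) (w : R) : 0 <= w ->
  #|[set f : {ffun 'I_n -> 'I_L} | [forall u, `|(f u)%:R - y u| <= w]]%SET|%:R
    <= (2 * w + 1) ^+ n.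
Proof.
move=> w0.
pose F u := [set i : 'I_L | `|i%:R - y u| <= w]%SET.
have -> : #|[set f : {ffun 'I_n -> 'I_L} |
    [forall u, `|(f u)%:R - y u| <= w]]%SET| = (\prod_u #|F u|)%N.
  rewrite -(cardsXn F); apply: eq_card => f; rewrite finset.inE.
  by apply/forallP/setXnP => h u; have := h u; rewrite finset.inE.
rewrite natr_prod.
apply: (@le_trans _ _ (\prod_(u < n) (2 * w + 1))).
  by apply: ler_prod => u _; rewrite ler0n /=; exact: card_near1.
by rewrite prodr_const card_ord.
Qed.

(** The induction step is the concavity bound [u^(1-b) <= (1-b) u + b] at [u = X/(X+1)], which for
    [b > 0] is Young's inequality with conjugate exponents [1/(1-b)] and [1/b]. *)
Lemma sum_powR_le {R : realType} (b : R) (X : nat) : 0 <= b -> b < 1 ->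
  \sum_(1 <= q < X.+1) q%:R `^ (- b) <= (1 - b)^-1 * X%:R `^ (1 - b).
Proof.
move=> b0 b1; have b1' : 0 < 1 - b by lra.
elim: X => [|X IH]; first by rewrite big_geq // mulr_ge0 ?powR_ge0 // invr_ge0 ltW.
rewrite big_nat_recr //=; apply: le_trans (lerD IH (lexx _)) _.
have X1 : 0 < X.+1%:R :> R by rewrite ltr0n.
rewrite -lerBrDl -mulrBr mulrC ler_pdivlMr //.
set u : R := X%:R / X.+1%:R.
have u0 : 0 <= u by rewrite mulr_ge0 // invr_ge0.
have XE : X%:R `^ (1 - b) = X.+1%:R `^ (1 - b) * u `^ (1 - b) :> R.
  by rewrite -powRM // ?ltW // /u mulrCA mulfV ?mulr1 // gt_eqF.
have hu : u `^ (1 - b) <= (1 - b) * u + b.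
  have [->|bn0] := eqVneq b 0; first by rewrite subr0 powRr1 // mul1r addr0.
  have bp : 0 < b by rewrite lt_def bn0.
  have := @conjugate_powR R (u `^ (1 - b)) 1 (1 - b)^-1 b^-1 (powR_ge0 _ _) ler01.
  rewrite !invr_gt0 !invrK mulr1 powR1 -powRrM mulfV ?gt_eqF // powRr1 // mul1r.
  by rewrite mulrC; apply => //; rewrite subrK.
have hX : X.+1%:R `^ (1 - b) = X.+1%:R * X.+1%:R `^ (- b) :> R.
  by rewrite powRD ?powRr1 ?ltW // (gt_eqF X1) implybT.
rewrite XE hX; set p := X.+1%:R `^ (- b); have p0 : 0 <= p by exact: powR_ge0.
have hv : X.+1%:R * (1 - u) = 1 :> R.
  by rewrite mulrBr mulr1 /u mulrCA mulfV ?gt_eqF // mulr1 -natr1 addrAC subrr add0r.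
set v := u `^ _ in hu *.
have h1 : (1 - b) * (1 - u) <= 1 - v by lra.
rewrite [leRHS](_ : _ = p * (X.+1%:R * (1 - v))); last by ring.
rewrite ler_wpM2l //.
apply: (@le_trans _ _ (X.+1%:R * ((1 - b) * (1 - u)))).
  by rewrite mulrCA hv mulr1.
by rewrite ler_pM2l.
Qed.

Lemma powR_eventually {R : realType} (b c : R) (B : R) : b < c ->
  exists N : nat, forall q : nat, (N <= q)%N -> B * q%:R `^ b <= q%:R `^ c.
Proof.
move=> bc; have cb : 0 < c - b by rewrite subr_gt0.
pose B' := Num.max B 1.
have B'0 : 0 < B' by rewrite lt_max ltr01 orbT.
exists (Num.truncn (B' `^ (c - b)^-1)).+1 => q hq.
have q0 : 0 < q%:R :> R by rewrite ltr0n (leq_trans _ hq).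
have : B' <= q%:R `^ (c - b).
  have h1 : B' `^ (c - b)^-1 <= q%:R.
    by apply/ltW/(lt_le_trans (truncnS_gt _)); rewrite ler_nat.
  have : (B' `^ (c - b)^-1) `^ (c - b) <= q%:R `^ (c - b).
    by apply: ge0_ler_powR; rewrite ?nnegrE ?powR_ge0 // ltW.
  by rewrite -powRrM mulVf ?lt0r_neq0 // powRr1 // ltW.
move=> h; apply: (@le_trans _ _ (q%:R `^ (c - b) * q%:R `^ b)).
  rewrite ler_wpM2r ?powR_ge0 //; apply: le_trans h; by rewrite le_max lexx.
by rewrite -powRD ?subrK // (gt_eqF q0) implybT.
Qed.

(** * A well-spaced family of rational points at one scale *)

Section near_points.
Context {R : realType} (n m : nat) (a : 'M[R]_(n, m)) (a0 : 'I_m -> R).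

Variable theta : R.
Hypotheses (n0 : (0 < n)%N) (m0 : (0 < m)%N) (theta0 : 0 < theta) (thetam : theta * m%:R < 1).
(** The form in which the Diophantine condition is used; the free [eps] accommodates cubes of any
    side, at the price of a larger threshold [q0]. *)
Hypothesis sep : forall eps : R, 0 < eps -> exists q0 : nat,
  forall q J P : nat, (q0 <= q)%N -> J%:R <= 3 * q%:R `^ theta ->
  eps * q%:R <= P%:R -> separated a P J.

Let beta := theta * m%:R.

(* [f] stands for the numerator [p = floor (q o) + f], so that [p / q] runs over
   a neighbourhood of the cube of corner [o] and side [h]. *)
Definition numerators (o : 'I_n -> R) (h : R) (q J : nat) :
    {set {ffun 'I_n -> 'I_(Num.truncn (q%:R * h)).+2}} :=
  [set f : {ffun 'I_n -> 'I_(Num.truncn (q%:R * h)).+2} | `[< exists z : 'I_m -> int, forall i,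
    (8 * m * J)%:R * `|\sum_u (Num.floor (q%:R * o u) + (f u)%:Z)%:~R * a u i
       + q%:R * a0 i - (z i)%:~R| <= 1 >]]%SET.

(** Separation is available only for [J] up to about [q^theta]. A larger [J] is lowered to [K],
    which relaxes the closeness condition and produces the term [q^(-beta)]. Denominators below the
    threshold cost a constant [B] that depends on [h] but not on the position [o]. *)
Lemma card_numerators (h : R) : 0 < h -> exists q0 : nat, exists2 B : R, 0 <= B &
  forall o q J, (0 < q)%N -> (0 < J)%N -> #|numerators o h q J|%:R <=
    8 * 2 ^+ m * 144 ^+ n * h ^+ n * q%:R ^+ n * (J%:R ^- m + q%:R `^ (- beta)) +
    (if (q < q0)%N then B else 0).
Proof.
move=> h0.
have [q1 hq1] := sep h0.
pose q0 := maxn q1 (Num.truncn (2 / h)).+1.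
exists q0, ((Num.truncn (q0%:R * h)).+2%:R ^+ n); first exact: exprn_ge0.
move=> o q J qpos Jpos.
have main0 : 0 <= 8 * 2 ^+ m * 144 ^+ n * h ^+ n * q%:R ^+ n *
    (J%:R ^- m + q%:R `^ (- beta)).
  have hn : 0 <= h ^+ n by rewrite exprn_ge0 // ltW.
  have e0 : 0 <= J%:R ^- m + q%:R `^ (- beta).
    by rewrite addr_ge0 ?powR_ge0 // invr_ge0 exprn_ge0.
  by rewrite !mulr_ge0 ?hn ?e0 ?exprn_ge0.
case: ifPn => [qq|]; last rewrite -leqNgt => qq.
{ apply: ler_wpDl => //.
  apply: (@le_trans _ _ ((Num.truncn (q%:R * h)).+2 ^ n)%:R).
    by rewrite ler_nat (leq_trans (max_card _)) // card_ffun !card_ord.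
  rewrite natrX lerXn2r ?nnegrE // ler_nat ltnS ltnS.
  by apply: le_truncn; rewrite ler_wpM2r ?(ltW h0) // ler_nat ltnW. }
rewrite addr0.
have qR : 0 < q%:R :> R by rewrite ltr0n.
set P := (Num.truncn (q%:R * h)).+2.
have qh0 : 0 <= q%:R * h by rewrite mulr_ge0 // ltW.
have /andP[t1 t2] := truncn_itv qh0.
have P1 : q%:R * h <= P%:R by apply/ltW/(lt_trans t2); rewrite ltr_nat.
have P2 : P%:R <= 2 * (q%:R * h).
  have : 2 / h <= q%:R.
    apply/ltW/(lt_le_trans (truncnS_gt _)); rewrite ler_nat.
    by apply: leq_trans qq; rewrite leq_maxr.
  rewrite ler_pdivrMr // => h2.
  by rewrite /P -addn2 natrD; lra.
pose K := Num.truncn (q%:R `^ theta : R).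
have /andP[k1 k2] := truncn_itv (powR_ge0 q%:R theta).
have qt1 : 1 <= q%:R `^ theta :> R.
  have := @ge0_ler_powR R theta (ltW theta0) 1 q%:R.
  by rewrite powR1 !nnegrE ler1n => ->.
have K0 : (0 < K)%N by rewrite truncn_gt0.
pose J1 := minn J K.
have J10 : (0 < J1)%N by rewrite leq_min Jpos.
have sepP : separated a P J1.
  apply: (hq1 q) => //; last by rewrite mulrC.
    by apply: leq_trans qq; rewrite leq_maxl.
  apply: (@le_trans _ _ K%:R); first by rewrite ler_nat geq_minr.
  apply: (le_trans k1); rewrite -/K; set v := _ `^ _ in qt1 *; lra.
have := @lattice_count R n m a
  (fun i => \sum_u (Num.floor (q%:R * o u))%:~R * a u i + q%:R * a0 i) P J1
  (ltn0Sn _) J10 sepP (numerators o h q J).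
have hA : forall p, p \in numerators o h q J -> exists z : 'I_m -> int, forall i,
    (8 * m * J1)%:R * `|\sum_u (p u)%:R * a u i +
     (\sum_u (Num.floor (q%:R * o u))%:~R * a u i + q%:R * a0 i) - (z i)%:~R| <= 1.
  move=> p; rewrite finset.inE => /asboolP[z hz]; exists z => i.
  apply: le_trans (hz i); rewrite addrA -big_split /=.
  have -> : \sum_u (Num.floor (q%:R * o u) + (p u)%:Z)%:~R * a u i =
      \sum_u ((p u)%:R * a u i + (Num.floor (q%:R * o u))%:~R * a u i).
    by apply: eq_bigr => u _; rewrite rmorphD /= -mulrDl addrC.
  by rewrite ler_wpM2r // ler_nat leq_mul2l geq_minl orbT.
move=> /(_ hA) hc.
have J1p : 0 < J1%:R ^+ m :> R by rewrite exprn_gt0 // ltr0n.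
have {}hc : #|numerators o h q J|%:R <= 4 * 72 ^+ n * P%:R ^+ n * J1%:R ^- m :> R.
  by rewrite ler_pdivlMr.
have Jinv : J1%:R ^- m <= J%:R ^- m + 2 ^+ m * q%:R `^ (- beta).
  have [JK|JK] := leqP J K.
    rewrite /J1 (minn_idPl JK); apply: ler_wpDr => //.
  rewrite /J1 (minn_idPr (ltnW JK)); apply: ler_wpDl.
    by rewrite invr_ge0 exprn_ge0.
  have -> : q%:R `^ (- beta) = (q%:R `^ theta) ^- m :> R.
    by rewrite powRN /beta powRrM powR_mulrn // powR_ge0.
  have qp : 0 < q%:R `^ theta :> R by rewrite powR_gt0.
  have Kp : 0 < K%:R :> R by rewrite ltr0n.
  rewrite -!exprVn -exprMn lerXn2r ?nnegrE ?mulr_ge0 ?invr_ge0 ?(ltW Kp) ?(ltW qp) //.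
  rewrite ler_pdivlMr // mulrC ler_pdivrMr //; apply: le_trans (ltW k2) _.
  by rewrite -natrM ler_nat mul2n -addnn -addn1 leq_add2l.
apply: (le_trans hc).
have Pn : P%:R ^+ n <= 2 ^+ n * (q%:R ^+ n * h ^+ n) :> R.
  by rewrite -!exprMn lerXn2r ?nnegrE ?mulr_ge0 // ltW.
have J0' : 0 <= J%:R ^- m :> R by rewrite invr_ge0 exprn_ge0.
have b0 : 0 <= q%:R `^ (- beta) :> R by exact: powR_ge0.
have m1 : 1 <= 2 ^+ m :> R by rewrite exprn_ege1 // ler1n.
have Jinv2 : J1%:R ^- m <= 2 ^+ m * (J%:R ^- m + q%:R `^ (- beta)).
  apply: (le_trans Jinv); rewrite mulrDr lerD2r; exact: ler_peMl.
apply: (@le_trans _ _ (4 * 72 ^+ n * (2 ^+ n * (q%:R ^+ n * h ^+ n)) *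
    (2 ^+ m * (J%:R ^- m + q%:R `^ (- beta))))).
  have u0 : 0 <= J1%:R ^- m :> R by rewrite invr_ge0 ltW.
  have v0 : 0 <= 4 * 72 ^+ n * P%:R ^+ n :> R by rewrite mulr_ge0 ?mulr_ge0 ?exprn_ge0.
  have w0 : 4 * 72 ^+ n * P%:R ^+ n <= 4 * 72 ^+ n * (2 ^+ n * (q%:R ^+ n * h ^+ n)).
    by rewrite ler_wpM2l // mulr_ge0 // exprn_ge0.
  exact: ler_pM.
have -> : 144 ^+ n = 72 ^+ n * 2 ^+ n :> R by rewrite -exprMn; congr (_ ^+ n); ring.
have : 0 <= 72 ^+ n * 2 ^+ n * (2 ^+ m) * (h ^+ n) * (q%:R ^+ n) *
    (J%:R ^- m + q%:R `^ (- beta)) :> R.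
  by rewrite !mulr_ge0 ?exprn_ge0 ?addr_ge0 // ltW.
lra.
Qed.


Section grid.
Variables (o : 'I_n -> R) (h : R) (Q J E M L : nat).

(** Bounds the error [1/(M q)] of a Dirichlet approximation whose denominator satisfies [q E > Q].
    The grid has this step and is meant for the middle half of the cube. *)
Let s : R := E%:R / (M%:R * Q%:R).

Definition grid_point (c : {ffun 'I_n -> 'I_L}) u : R :=
  o u + h / 4 + s * (c u)%:R.

Definition bad_grid : {set {ffun 'I_n -> 'I_L}} :=
  [set c : {ffun 'I_n -> 'I_L} | `[< exists (q : nat) (p : 'I_n -> int) (z : 'I_m -> int),
   [/\ (0 < q)%N, (q * E <= Q)%N,
    (forall u, M%:R * `|q%:R * grid_point c u - (p u)%:~R| < 1) &
    forall i, (8 * m * J)%:R *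
      `|\sum_u (p u)%:~R * a u i + q%:R * a0 i - (z i)%:~R| < 1] >]]%SET.

(** Double counting over small denominators [q] and their numerators. A fraction [p/q] serves only
    grid points within [1/(M q)] of it, that is within [Q/(q E)] grid steps; as this number is at
    least 1, there are at most [(3 Q/(q E))^n] of them. The margin [h/4], at least [1/M], keeps [p]
    among the numerators of the cube. *)
Lemma card_bad_grid : (0 < E)%N -> (0 < Q)%N -> 0 < h -> 4 <= M%:R * h ->
  s * L%:R <= h / 2 ->
  #|bad_grid|%:R <= \sum_(1 <= q < (Q %/ E).+1)
    (3 * (Q%:R / (q%:R * E%:R))) ^+ n * #|numerators o h q J|%:R :> R.
Proof.
move=> E0 Q0 h0 Mh sL.
have M0 : 0 < M%:R :> R by rewrite -(pmulr_lgt0 _ h0) (lt_le_trans _ Mh).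
have QR : 0 < Q%:R :> R by rewrite ltr0n.
have ER : 0 < E%:R :> R by rewrite ltr0n.
have s0 : 0 < s by rewrite divr_gt0 // mulr_gt0.
pose w q : R := Q%:R / (q%:R * E%:R).
(* The position of the fraction [p/q] in grid units. *)
pose y q (f : {ffun 'I_n -> 'I_(Num.truncn (q%:R * h)).+2}) u : R :=
  ((Num.floor (q%:R * o u) + (f u)%:Z)%:~R / q%:R - o u - h / 4) / s.
pose nearb q f (c : {ffun 'I_n -> 'I_L}) :=
  [forall u, `|(c u)%:R - @y q f u| <= w q].
have hbad c : c \in bad_grid -> exists q, exists2 f, [/\ (0 < q)%N,
    (q < (Q %/ E).+1)%N & f \in numerators o h q J] & nearb q f c.
  rewrite finset.inE => /asboolP[q [p [z [q0 qE hp hz]]]].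
  have qR : 0 < q%:R :> R by rewrite ltr0n.
  have q1 : 1 <= q%:R :> R by rewrite ler1n.
  have hg u : o u + h / 4 <= grid_point c u <= o u + 3 * h / 4.
    have := ltn_ord (c u); rewrite -(ltr_nat R) => cL.
    have c0 : 0 <= s * (c u)%:R by rewrite mulr_ge0 // ltW.
    have : s * (c u)%:R <= s * L%:R by rewrite ler_pM2l // ltW.
    by rewrite /grid_point => ?; apply/andP; split; lra.
  have hp2 u : `|q%:R * grid_point c u - (p u)%:~R| < h / 4.
    have := hp u; set v := `|_| => hv.
    rewrite -(ltr_pM2l M0); apply: lt_le_trans hv _; lra.
  have key (k l : int) (t : nat) : l < k -> k < l + t%:Z ->
      0 <= k - l /\ (absz (k - l) < t)%N by clear; lia.
  have hf u : 0 <= p u - Num.floor (q%:R * o u) /\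
      (absz (p u - Num.floor (q%:R * o u)) < (Num.truncn (q%:R * h)).+2)%N.
    have /andP[g1 g2] := hg u; have := hp2 u; rewrite ltr_norml => /andP[p1 p2].
    have /andP[f1 f2] := floor_itv (q%:R * o u).
    have qh : h <= q%:R * h by rewrite ler_peMl // ltW.
    have := truncnS_gt (q%:R * h); set T := Num.truncn _ => hT.
    have k1 : q%:R * (o u + h / 4) <= q%:R * grid_point c u by rewrite ler_pM2l.
    have k2 : q%:R * grid_point c u <= q%:R * (o u + 3 * h / 4) by rewrite ler_pM2l.
    have r0 : (Num.floor (q%:R * o u))%:~R < (p u)%:~R :> R by nra.
    have r1 : (p u)%:~R < (Num.floor (q%:R * o u) + T.+2%:Z)%:~R :> R.
      rewrite rmorphD /=; move: f2; rewrite rmorphD /= -[T.+2%:~R]natr1; nra.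
    rewrite ltr_int in r0; rewrite ltr_int in r1.
    exact: key r0 r1.
  exists q, [ffun u => inord (absz (p u - Num.floor (q%:R * o u)))].
    have fE u : Num.floor (q%:R * o u) +
       ([ffun u => inord (absz (p u - Num.floor (q%:R * o u)))] u :
         'I_(Num.truncn (q%:R * h)).+2)%:Z = p u.
      by have [f1 f2] := hf u; rewrite ffunE inordK // gez0_abs // [LHS]addrC subrK.
    split=> //; first by rewrite ltnS leq_divRL.
    rewrite finset.inE; apply/asboolP; exists z => i; apply/ltW.
    by under eq_bigr => u _ do rewrite fE; exact: hz.
  apply/forallP => u; rewrite /y ffunE inordK; last by case: (hf u).
  rewrite gez0_abs; last by case: (hf u).
  rewrite [Num.floor _ + _]addrC subrK.
  have := hp u.
  have -> : q%:R * grid_point c u - (p u)%:~R = q%:R * s *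
      ((c u)%:R - ((p u)%:~R / q%:R - o u - h / 4) / s).
    by rewrite /grid_point; field; rewrite (gt_eqF s0) (gt_eqF qR).
  have qs0 : 0 < q%:R * s by rewrite mulr_gt0.
  rewrite normrM (gtr0_norm qs0) => hh.
  rewrite ltW // /w; have -> : Q%:R / (q%:R * E%:R) = (M%:R * (q%:R * s))^-1.
    by rewrite /s; field; rewrite !gt_eqF.
  have lt_inv (A t : R) : 0 < A -> A * t < 1 -> t < A^-1.
    by move=> A0; rewrite -[A^-1]mul1r ltr_pdivlMr // mulrC.
  apply: lt_inv; first by rewrite mulr_gt0.
  by rewrite -[ltLHS]mulrA.
have -> : #|bad_grid|%:R = \sum_(c in bad_grid) (1 : R) by rewrite sumr_const.
apply: (@le_trans _ _ (\sum_c \sum_(1 <= q < (Q %/ E).+1)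
   \sum_(f in numerators o h q J) (nearb q f c)%:R)).
  rewrite [leLHS]big_mkcond /=; apply: ler_sum => c _; case: ifPn => [cb|_].
    have [q [f [q0 qQ fA] fc]] := hbad c cb.
    rewrite (bigD1_seq q) ?mem_index_iota ?iota_uniq ?q0 //=.
    rewrite (bigD1 f) //= fc -addrA lerDl addr_ge0 ?sumr_ge0 // => *.
    by rewrite sumr_ge0.
  by rewrite sumr_ge0 // => q _; rewrite sumr_ge0.
rewrite exchange_big /= big_nat [leRHS]big_nat; apply: ler_sum => q /andP[q0 qQ].
rewrite exchange_big /= [leRHS]mulr_natr -sumr_const; apply: ler_sum => f _.
rewrite -natr_sum -big_mkcond /= sum1_card.
have qR : 0 < q%:R :> R by rewrite ltr0n.
have w1 : 1 <= w q.
  rewrite /w ler_pdivlMr ?mulr_gt0 // mul1r -natrM ler_nat.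
  by rewrite -leq_divRL.
have w0 : 0 <= w q by apply: le_trans w1.
have := card_near L (@y q f) w0; rewrite cardsE => hcn.
apply: le_trans hcn _; rewrite -/(w q) lerXn2r ?nnegrE ?addr_ge0 ?mulr_ge0 //; lra.
Qed.

End grid.

(** The factor [(Q/(q E))^n] cancels the [q^n] of the count, leaving a sum of [J^(-m) + q^(-beta)]
    over [q <= Y = Q/E]; since [beta < 1], its second part is of order [Y^(1-beta)]. *)
Lemma bad_sum_le (h B : R) (o : 'I_n -> R) (Q J E q0 : nat) :
  (0 < E)%N -> (0 < Q)%N -> (0 < J)%N -> 0 < h -> 0 <= B ->
  (forall q, (0 < q)%N -> #|numerators o h q J|%:R <=
    8 * 2 ^+ m * 144 ^+ n * h ^+ n * q%:R ^+ n * (J%:R ^- m + q%:R `^ (- beta)) +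
    (if (q < q0)%N then B else 0)) ->
  \sum_(1 <= q < (Q %/ E).+1)
    (3 * (Q%:R / (q%:R * E%:R))) ^+ n * #|numerators o h q J|%:R <=
  (3 * (Q%:R / E%:R)) ^+ n * (8 * 2 ^+ m * 144 ^+ n * h ^+ n *
    (Q%:R / E%:R * J%:R ^- m + (1 - beta)^-1 * (Q%:R / E%:R) `^ (1 - beta)) +
    B * q0%:R).
Proof.
move=> E0 Q0 J0 h0 B0 hq.
have ER : 0 < E%:R :> R by rewrite ltr0n.
set Y : R := Q%:R / E%:R; set C : R := 8 * 2 ^+ m * 144 ^+ n.
have Y0 : 0 <= Y by rewrite mulr_ge0 // invr_ge0.
have hn : 0 <= h ^+ n by rewrite exprn_ge0 // ltW.
have C0 : 0 <= C by rewrite /C !mulr_ge0 ?exprn_ge0.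
have XY : (Q %/ E)%:R <= Y by rewrite ler_pdivlMr // -natrM ler_nat leq_divM.
apply: (@le_trans _ _ (\sum_(1 <= q < (Q %/ E).+1) (3 * Y) ^+ n *
    (C * h ^+ n * (J%:R ^- m + q%:R `^ (- beta)) + (if (q < q0)%N then B else 0)))).
  rewrite big_nat [leRHS]big_nat; apply: ler_sum => q /andP[q1 qQ].
  have qR : 0 < q%:R :> R by rewrite ltr0n.
  have qn : 0 < q%:R ^+ n :> R by rewrite exprn_gt0.
  apply: le_trans (ler_wpM2l _ (hq q q1)) _.
    by rewrite exprn_ge0 // mulr_ge0 // divr_ge0 // mulr_ge0.
  have -> : (3 * (Q%:R / (q%:R * E%:R))) ^+ n = (3 * Y) ^+ n * q%:R ^- n.
    by rewrite -exprVn -exprMn /Y; congr (_ ^+ n); field; rewrite !gt_eqF.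
  rewrite -[leLHS]mulrA ler_wpM2l ?exprn_ge0 ?mulr_ge0 //.
  rewrite mulrDr; apply: lerD.
    rewrite -/C [leLHS](_ : _ = C * h ^+ n * (J%:R ^- m + q%:R `^ (- beta)) *
      (q%:R ^- n * q%:R ^+ n)); last by ring.
    by rewrite mulVf ?mulr1 // gt_eqF.
  case: ifP => _; last by rewrite mulr0.
  by rewrite ler_piMl // invf_le1 // exprn_ege1 // ler1n.
rewrite -mulr_sumr ler_wpM2l ?exprn_ge0 ?mulr_ge0 // big_split /=; apply: lerD.
  rewrite -mulr_sumr ler_wpM2l ?mulr_ge0 // big_split /=; apply: lerD.
    rewrite sumr_const_nat subn1 /= -[leLHS]mulr_natr mulrC ler_wpM2r //.
  have beta0 : 0 <= beta by rewrite mulr_ge0 // ltW.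
  apply: le_trans (sum_powR_le _ beta0 thetam) _.
  rewrite ler_wpM2l ?invr_ge0 ?subr_ge0 ?(ltW thetam) //.
  by rewrite ge0_ler_powR ?nnegrE // subr_ge0 ltW.
rewrite -big_mkcond /= big_const_seq iter_addr_0 -[leLHS]mulr_natr.
rewrite ler_wpM2l // ler_nat -size_filter -[leqRHS](size_iota 0).
apply: uniq_leq_size; first by rewrite filter_uniq ?iota_uniq.
by move=> q; rewrite mem_filter mem_iota add0n => /andP[].
Qed.

(** Arithmetic for [good_points] with each power a separate variable: [hn = h^n], [Jm = J^m],
    [Mn = M^n], [qb = Q^beta], [eb = E^beta], [yb = Y^(1-beta)]. [hE] makes the main term small, and
    [hQ] absorbs the constant due to denominators below the threshold; each is allotted half of
    [hn * Q]. *)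
Lemma grid_estimate (V W C K B t q0 hn Q Y E Jm Mn qb eb yb : R) :
  0 < W -> 0 <= V -> 0 <= C -> 0 <= K -> 0 <= B -> 0 <= t -> 0 <= q0 -> 0 < hn ->
  0 <= Y -> 0 < Jm -> 0 <= yb -> 1 <= eb ->
  Q = E * Y -> qb * yb = eb * Y -> Jm <= t * qb ->
  4 * V * W * C * (1 + K * t) * eb <= E ->
  4 * V * W * t * B * q0 / hn * qb <= Q -> Q <= Mn * W * Jm ->
  2 * (V * (C * hn * (Y / Jm + K * yb) + B * q0)) <= hn * Mn.
Proof.
move=> W0 V0 C0 K0 B0 t0 q00 hn0 Y0 Jm0 yb0 eb1 QE qy Jt hE hQ hM.
have WJ : 0 < W * Jm by rewrite mulr_gt0.
rewrite -(ler_pM2r WJ).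
apply: (@le_trans _ _ (hn * Q)); last by rewrite -mulrA ler_pM2l // mulrA.
have yJ : Y / Jm * Jm = Y by rewrite mulfVK // gt_eqF.
have h1 : yb * Jm <= t * (eb * Y).
  by have := ler_wpM2l yb0 Jt; rewrite -qy; lra.
have VW : 0 <= V * W by rewrite mulr_ge0 // ltW.
have h2 : 2 * (V * W) * (C * hn) * (Y + K * (yb * Jm)) <= hn * Q / 2.
  apply: (@le_trans _ _ (2 * (V * W) * (C * hn) * ((1 + K * t) * eb * Y))).
    have P0 : 0 <= 2 * (V * W) * (C * hn).
      by apply: mulr_ge0; apply: mulr_ge0 => //; exact: ltW.
    rewrite (ler_wpM2l P0) //.
    rewrite mulrDl mulrDl mul1r; apply: lerD; first exact: ler_peMl.
    by rewrite -!mulrA ler_wpM2l.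
  rewrite QE; have := ler_wpM2r (mulr_ge0 (ltW hn0) Y0) hE; lra.
have h3 : 2 * (V * W) * (Jm * (B * q0)) <= hn * Q / 2.
  apply: (@le_trans _ _ (2 * (V * W) * (t * qb * (B * q0)))).
    have P0 : 0 <= 2 * (V * W) by exact: mulr_ge0.
    by rewrite (ler_wpM2l P0) // ler_wpM2r // mulr_ge0.
  have := ler_wpM2l (ltW hn0) hQ.
  have -> : hn * (4 * V * W * t * B * q0 / hn * qb) =
     4 * V * W * t * B * q0 * qb by field; rewrite gt_eqF.
  lra.
have -> : 2 * (V * (C * hn * (Y / Jm + K * yb) + B * q0)) * (W * Jm) =
  2 * (V * W) * (C * hn) * (Y / Jm * Jm + K * (yb * Jm)) +
  2 * (V * W) * (Jm * (B * q0)) by ring.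
by rewrite yJ; lra.
Qed.

(** The points are Dirichlet approximations to the grid points that are not bad, at least half of
    the grid. [E], [c1], [c2] precede [h], and only [Q0] depends on it: hence a proportion common to
    all cells. [X] may repeat points; each lies within [s] of its own grid point, so the counting
    clause bounds repetitions as well. *)
Lemma good_points : exists (E : nat) (c1 c2 : R),
  [/\ (0 < E)%N, 0 < c1, 0 < c2 & forall h, 0 < h -> exists Q0 : nat,
   forall o Q J, (Q0 <= Q)%N -> (0 < J)%N -> J%:R <= 3 * Q%:R `^ theta ->
   exists (s : R) (X : seq {ffun 'I_n -> R}),
   [/\ 0 < s,
    (forall x, x \in X -> (forall u, o u + h / 8 <= x u <= o u + 7 * h / 8) /\
      exists (q : nat) (p : 'I_n -> int) (z : 'I_m -> int),
      [/\ (0 < q <= Q)%N, (Q < q * E)%N, (forall u, x u = (p u)%:~R / q%:R) &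
       forall i, (8 * m * J)%:R *
         `|\sum_u (p u)%:~R * a u i + q%:R * a0 i - (z i)%:~R| < 1]),
    c1 * h ^+ n <= (size X)%:R * s ^+ n,
    (forall (y : 'I_n -> R) rho, 0 <= rho ->
      (count (fun x : {ffun 'I_n -> R} => [forall u, `|x u - y u| <= rho]) X)%:R
        <= (2 * rho / s + 3) ^+ n) &
    c2 * Q%:R ^+ n.+1 / J%:R ^+ m <= s ^- n]].
Proof.
pose V : R := 12 ^+ n; pose W : R := 2 ^+ n * (8 * m)%:R ^+ m.
pose C : R := 8 * 2 ^+ m * 144 ^+ n; pose K := (1 - beta)^-1; pose t : R := 3 ^+ m.
have m8 : 0 < (8 * m)%:R :> R by rewrite ltr0n muln_gt0.
have W0 : 0 < W by rewrite mulr_gt0 ?exprn_gt0.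
have V0 : 0 <= V by rewrite exprn_ge0.
have C0 : 0 <= C by rewrite /C !mulr_ge0 ?exprn_ge0.
have K0 : 0 <= K by rewrite invr_ge0 subr_ge0 ltW.
have t0 : 0 <= t by rewrite exprn_ge0.
have beta0 : 0 <= beta by rewrite mulr_ge0 // ltW.
(* Since [beta < 1], a large constant [E] beats any multiple of [E^beta]; this makes the bad grid
   points at most half of all. *)
have [E1 hE1] := powR_eventually (4 * V * W * C * (1 + K * t)) thetam.
pose E := maxn 1 E1; have E0 : (0 < E)%N by rewrite leq_maxl.
have hE : 4 * V * W * C * (1 + K * t) * E%:R `^ beta <= E%:R.
  by have := hE1 E (leq_maxr _ _); rewrite powRr1.
have ER : 0 < E%:R :> R by rewrite ltr0n.
exists E, ((2 * 4 ^+ n)^-1), ((E%:R ^+ n * W)^-1).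
split; [by []|by rewrite invr_gt0 mulr_gt0 ?exprn_gt0|
  by rewrite invr_gt0 mulr_gt0 ?exprn_gt0|].
move=> h h0; have [q0 [B B0 hB]] := card_numerators h0.
have hn0 : 0 < h ^+ n by rewrite exprn_gt0.
(* A lower bound for the later [M]: [M h >= 4] is the margin needed by [card_bad_grid], and
   [M h >= 8 E] gives [s <= h/8]. *)
pose T := (Num.truncn (4 / h + 8 * E%:R / h)).+1.
have hT : 4 / h + 8 * E%:R / h <= T%:R by apply/ltW/truncnS_gt.
have T4 : 4 <= T%:R * h.
  rewrite -ler_pdivrMr //; apply: le_trans hT; rewrite lerDl.
  by rewrite divr_ge0 ?mulr_ge0 // ltW.
have T8 : 8 * E%:R <= T%:R * h.
  rewrite -ler_pdivrMr //; apply: le_trans hT; rewrite lerDr.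
  by rewrite divr_ge0 // ltW.
have [N hN] := powR_eventually (T%:R ^+ n * (24 * m)%:R ^+ m +
   4 * V * W * t * B * q0%:R / h ^+ n) thetam.
exists (maxn 1 N) => o Q J; rewrite geq_max => /andP[Q1 QN] J0 JQ.
have QR : 0 < Q%:R :> R by rewrite ltr0n.
have JR : 0 < J%:R :> R by rewrite ltr0n.
have qb0 : 0 <= Q%:R `^ beta :> R by exact: powR_ge0.
have qbE : (Q%:R `^ theta) ^+ m = Q%:R `^ beta by rewrite /beta powRrM powR_mulrn // powR_ge0.
have := hN Q QN; rewrite powRr1 ?(ltW QR) // mulrDl => hQ.
have hQ1 : T%:R ^+ n * (24 * m)%:R ^+ m * Q%:R `^ beta <= Q%:R.
  apply: le_trans hQ; rewrite lerDl mulr_ge0 // divr_ge0 ?(ltW hn0) //.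
  by rewrite !mulr_ge0 // ltW.
have hQ2 : 4 * V * W * t * B * q0%:R / h ^+ n * Q%:R `^ beta <= Q%:R.
  by apply: le_trans hQ; rewrite lerDr !mulr_ge0 ?exprn_ge0.
pose M2 := (8 * m * J)%N.
have M20 : (0 < M2)%N by rewrite !muln_gt0 m0.
have TP : (T ^ n * M2 ^ m <= Q)%N.
  rewrite -(ler_nat R) natrM !natrX; apply: le_trans hQ1.
  rewrite -mulrA ler_wpM2l ?exprn_ge0 // -qbE -exprMn lerXn2r ?nnegrE //.
  rewrite /M2 natrM (_ : (24 * m)%:R = (8 * m)%:R * 3); last by rewrite !natrM; ring.
  by rewrite -mulrA ler_wpM2l.
(* [M] will be the finest precision for which the pigeonhole works, so that [M^n] is comparable to
   [Q / J^m]; its maximality gives [QM]. *)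
have exP : exists M : nat, (M ^ n * M2 ^ m <= Q)%N by exists T.
have ubP M : (M ^ n * M2 ^ m <= Q)%N -> (M <= Q)%N.
  move=> MP; apply: leq_trans MP; case: M => // M.
  apply: leq_trans (_ : M.+1 ^ n <= _)%N; first by rewrite -[leqLHS]expn1 leq_pexp2l.
  by rewrite leq_pmulr // expn_gt0 M20.
have [M MP Mmax] := ex_maxnP exP ubP.
have TM := Mmax _ TP.
have M0 : (0 < M)%N by apply: leq_trans TM.
have MR : 0 < M%:R :> R by rewrite ltr0n.
have QM : Q%:R <= M%:R ^+ n * W * J%:R ^+ m :> R.
  have : (Q < M.+1 ^ n * M2 ^ m)%N.
    by rewrite ltnNge; apply/negP => /Mmax; rewrite ltnn.
  move=> /ltnW; rewrite -(ler_nat R) natrM !natrX => /le_trans; apply.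
  rewrite /W /M2 natrM exprMn !mulrA ler_wpM2r ?exprn_ge0 //.
  rewrite ler_wpM2r ?exprn_ge0 // -exprMn lerXn2r ?nnegrE ?mulr_ge0 //.
  by rewrite -natrM ler_nat muln2 -addnn -addn1 leq_add2l.
have [s sE] : exists s : R, s = E%:R / (M%:R * Q%:R) by eexists.
have s0 : 0 < s by rewrite sE divr_gt0 // mulr_gt0.
have s8 : s <= h / 8.
  rewrite sE ler_pdivrMr ?mulr_gt0 //.
  have T8M : 8 * E%:R <= M%:R * h.
    by apply: le_trans T8 _; rewrite ler_pM2r // ler_nat.
  have MQ : M%:R * h <= M%:R * h * Q%:R by rewrite ler_peMr ?mulr_ge0 ?ler1n // ltW.
  lra.
(* As many steps as fit in half the side; rounding down loses at most a factor 2. *)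
pose L := Num.truncn (h / (2 * s)).
have hs0 : 0 <= h / (2 * s) by rewrite divr_ge0 ?mulr_ge0 // ltW.
have /andP[L1 L2] := truncn_itv hs0; rewrite -/L in L1 L2.
clearbody L.
have sL : s * L%:R <= h / 2.
  apply: le_trans (ler_wpM2l (ltW s0) L1) _.
  by rewrite le_eqVlt; apply/orP; left; apply/eqP; field; rewrite gt_eqF.
have Lge : h / (4 * s) <= L%:R.
  have : 2 <= h / (4 * s) by rewrite ler_pdivlMr ?mulr_gt0 //; lra.
  have hE2 : h / (2 * s) = 2 * (h / (4 * s)) by field; rewrite gt_eqF.
  move: L2; rewrite hE2 -natr1; lra.
set Y : R := Q%:R / E%:R.
have Y0 : 0 < Y by rewrite divr_gt0.
have M4 : 4 <= M%:R * h by apply: le_trans T4 _; rewrite ler_pM2r // ler_nat.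
pose bad := bad_grid o h Q J E M L.
have badle : 2 * #|bad|%:R <= L%:R ^+ n :> R.
  have sL' := sL; rewrite sE in sL'.
  have b1 := @card_bad_grid o h Q J E M L E0 Q1 h0 M4 sL'.
  have b2 := @bad_sum_le h B o Q J E q0 E0 Q1 J0 h0 B0 (fun q q_0 => hB o q J q_0 J0).
  have := le_trans b1 b2; rewrite -/bad -/Y -/C -/K => b3.
  have est := @grid_estimate V W C K B t q0%:R (h ^+ n) Q%:R Y E%:R (J%:R ^+ m)
    (M%:R ^+ n) (Q%:R `^ beta) (E%:R `^ beta) (Y `^ (1 - beta)) W0 V0 C0 K0 B0 t0.
  have QEY : Q%:R = E%:R * Y by rewrite /Y mulrCA mulfV ?mulr1 // gt_eqF.
  have {}est : 2 * (V * (C * h ^+ n * (Y / J%:R ^+ m + K * Y `^ (1 - beta)) +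
      B * q0%:R)) <= h ^+ n * M%:R ^+ n.
    apply: est => //; rewrite ?exprn_gt0 ?powR_ge0 ?(ltW Y0) //.
    { have := @ge0_ler_powR R beta beta0 1 E%:R.
      by rewrite powR1 !nnegrE ler1n => ->. }
    { rewrite QEY powRM ?(ltW ER) ?(ltW Y0) // -mulrA -powRD ?(gt_eqF Y0) ?implybT //.
      by rewrite addrC subrK powRr1 // ltW. }
    by rewrite -qbE /t -exprMn lerXn2r ?nnegrE ?mulr_ge0 ?powR_ge0.
  apply: (@le_trans _ _ ((h / (4 * s)) ^+ n)); last first.
    by rewrite lerXn2r ?nnegrE ?divr_ge0 ?mulr_ge0 ?(ltW s0) ?(ltW h0).
  have -> : h / (4 * s) = Y / 4 * (h * M%:R).
    by rewrite sE /Y; field; rewrite !gt_eqF.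
  rewrite exprMn [(h * _) ^+ n]exprMn.
  have Y4 : 0 <= (Y / 4) ^+ n by rewrite exprn_ge0 // divr_ge0 // ltW.
  apply: le_trans (ler_wpM2l Y4 est).
  have e3 : (3 * Y) ^+ n = V * (Y / 4) ^+ n.
    by rewrite /V -exprMn; congr (_ ^+ n); field.
  rewrite e3 in b3; set Z := _ + B * _ in b3 *.
  rewrite (_ : _ * (2 * (V * Z)) = 2 * (V * (Y / 4) ^+ n * Z)); last by ring.
  by rewrite ler_pM2l.
pose prop (c : {ffun 'I_n -> 'I_L}) (x : {ffun 'I_n -> R}) := 
  (forall u, `|x u - grid_point o h Q E M c u| <= s) /\
  exists (q : nat) (p : 'I_n -> int) (z : 'I_m -> int),
      [/\ (0 < q <= Q)%N, (Q < q * E)%N, (forall u, x u = (p u)%:~R / q%:R) &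
       forall i, (8 * m * J)%:R *
         `|\sum_u (p u)%:~R * a u i + q%:R * a0 i - (z i)%:~R| < 1].
have : forall c, exists x, c \notin bad -> prop c x.
  (* Bad grid points get the dummy value 0 and are left out of the family. *)
  move=> c; have [cb|cb] := boolP (c \in bad); first by exists [ffun=> 0].
  have [q [p [z [/andP[q_0 qQ] hp hz]]]] :=
    graph_dirichlet a a0 (grid_point o h Q E M c) M0 M20 MP.
  have qE : (Q < q * E)%N.
    rewrite ltnNge; apply: contra cb => qE; rewrite finset.inE; apply/asboolP.
    by exists q, p, z; split.
  exists [ffun u => (p u)%:~R / q%:R] => _; split=> [u|].
    rewrite ffunE; have qR : 0 < q%:R :> R by rewrite ltr0n.
    rewrite (_ : _ / _ - _ = - ((q%:R * grid_point o h Q E M c u - (p u)%:~R) / q%:R)); last first.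
      by field; rewrite gt_eqF.
    rewrite normrN normrM normfV (gtr0_norm qR) ler_pdivrMr //.
    rewrite -(ler_pM2l MR); apply: le_trans (ltW (hp u)) _.
    rewrite sE (_ : M%:R * (E%:R / (M%:R * Q%:R) * q%:R) = (q * E)%:R / Q%:R); last first.
      by rewrite natrM; field; rewrite !gt_eqF.
    by rewrite ler_pdivlMr // mul1r ler_nat ltnW.
  exists q, p, z; split=> //; first by rewrite q_0.
  by move=> u; rewrite ffunE.
move=> /choice[xof hx].
pose G := (~: bad)%SET.
have Gge : L%:R ^+ n / 2 <= #|G|%:R :> R.
  have : (#|bad| + #|G|)%N = (L ^ n)%N by rewrite cardsC card_ffun !card_ord.
  move=> /(congr1 (fun k : nat => k%:R : R)); rewrite natrD natrX; lra.
exists s, [seq xof c | c <- enum G]; split => //.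
- move=> x /mapP[c]; rewrite mem_enum finset.inE => cG ->.
  have [hc hr] := hx c cG; split => // u.
  have := hc u; rewrite ler_norml /grid_point -sE => /andP[c1 c2].
  have sc0 : 0 <= s * (c u)%:R by rewrite mulr_ge0 // ltW.
  have scL : s * (c u)%:R <= s * L%:R by rewrite ler_pM2l // ler_nat ltnW.
  by apply/andP; split; lra.
- rewrite size_map -cardE.
  apply: (@le_trans _ _ ((h / (4 * s)) ^+ n / 2 * s ^+ n)).
    rewrite le_eqVlt; apply/orP; left; apply/eqP.
    rewrite mulrAC -exprMn (_ : h / (4 * s) * s = h / 4); last first.
      by field; rewrite gt_eqF.
    by rewrite exprMn exprVn; field; rewrite gt_eqF // exprn_gt0.
  rewrite ler_wpM2r ?exprn_ge0 ?(ltW s0) //; apply: le_trans Gge.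
  rewrite ler_wpM2r // lerXn2r ?nnegrE ?divr_ge0 ?mulr_ge0 ?(ltW s0) ?(ltW h0) //.
- move=> y rho rho0; rewrite count_map -size_filter.
  apply: le_trans (_ : _ <= #|[set f : {ffun 'I_n -> 'I_L} |
    [forall u, `|(f u)%:R - (y u - o u - h / 4) / s| <= rho / s + 1]]%SET|%:R) _; last first.
    have w0 : 0 <= rho / s + 1 by rewrite addr_ge0 // divr_ge0 // ltW.
    apply: le_trans (card_near _ _ w0) _.
    by rewrite (_ : 2 * (rho / s + 1) + 1 = 2 * rho / s + 3) //; ring.
  rewrite ler_nat cardE; apply: uniq_leq_size.
    by rewrite filter_uniq // enum_uniq.
  move=> c; rewrite mem_filter mem_enum => /andP[/forallP hy].
  rewrite finset.inE => cG; rewrite mem_enum finset.inE.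
  have [hc _] := hx c cG.
  apply/forallP => u.
  have -> : (c u)%:R - (y u - o u - h / 4) / s = (grid_point o h Q E M c u - y u) / s.
    by rewrite /grid_point -sE; field; rewrite gt_eqF.
  rewrite normrM normfV (gtr0_norm s0) ler_pdivrMr // mulrDl mul1r mulfVK ?gt_eqF //.
  have := hc u; rewrite distrC => h1.
  rewrite -(subrKA (xof c u)); apply: le_trans (ler_normD _ _) _.
  by rewrite addrC; apply: lerD => //; exact: hy.
- have snE : s ^- n = M%:R ^+ n * (Q%:R / E%:R) ^+ n.
    by rewrite -exprVn -exprMn; congr (_ ^+ n); rewrite sE; field; rewrite !gt_eqF.
  rewrite snE exprMn exprVn exprS.
  have -> : (E%:R ^+ n * W)^-1 * (Q%:R * Q%:R ^+ n) / J%:R ^+ m =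
     (Q%:R / (W * J%:R ^+ m)) * (Q%:R ^+ n / E%:R ^+ n).
    by field; rewrite !gt_eqF ?exprn_gt0.
  rewrite ler_wpM2r ?divr_ge0 ?exprn_ge0 //.
  by rewrite ler_pdivrMr ?mulr_gt0 ?exprn_gt0 // mulrA.
Qed.

End near_points.

(** * Second moment bound for boxes taken over many scales *)

(* The right-hand side is the integral over [D] of [(sum_i 1_(A i) - l)^2]; the
   induction removes one set [A i0], which shifts [l] by 1 on [A i0]. *)
Lemma second_moment d (T : measurableType d) (R : realType)
    (mu : {measure set T -> \bar R}) (I : Type) (A : I -> set T) (r : seq I)
    (D : set T) (l : R) :
  (forall i, measurable (A i)) -> measurable D -> (mu D < +oo)%E ->
  0 <= \sum_(i <- r) \sum_(j <- r) fine (mu (A i `&` A j `&` D))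
       - 2 * l * \sum_(i <- r) fine (mu (A i `&` D)) + l ^+ 2 * fine (mu D).
Proof.
move=> mA; elim: r D l => [|i0 r IH] D l mD Doo.
  by rewrite !big_nil mulr0 subrr add0r mulr_ge0 ?sqr_ge0 // fine_ge0.
pose D1 := A i0 `&` D; pose D2 := D `\` A i0.
have mD1 : measurable D1 by exact: measurableI.
have mD2 : measurable D2 by exact: measurableD.
have sub_oo (B : set T) : measurable B -> B `<=` D -> (mu B < +oo)%E.
  by move=> mB BD; apply: le_lt_trans Doo; apply: le_measure; rewrite ?inE.
have D1oo : (mu D1 < +oo)%E by apply: sub_oo => // t [].
have D2oo : (mu D2 < +oo)%E by apply: sub_oo => // t [].
have split_fine (B : set T) : measurable B ->
    fine (mu (B `&` D)) = fine (mu (B `&` D1)) + fine (mu (B `&` D2)).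
  move=> mB; rewrite -fineD; first last.
  { rewrite ge0_fin_numE //; apply: sub_oo; first exact: measurableI.
    by move=> t [_ []]. }
  { rewrite ge0_fin_numE //; apply: sub_oo; first exact: measurableI.
    by move=> t [_ []]. }
  have disj : B `&` D1 `&` (B `&` D2) = set0.
    by apply/seteqP; split => // t [[_ [At _]] [_ [_ nAt]]].
  rewrite -(measureU mu (measurableI _ _ mB mD1) (measurableI _ _ mB mD2) disj).
  congr (fine (mu _)); apply/seteqP; split => [t [Bt Dt]|t].
    by have [At|At] := pselect (A i0 t); [left|right].
  by case=> [[Bt [_ Dt]]|[Bt [Dt _]]].
have := addr_ge0 (IH D1 (l - 1) mD1 D1oo) (IH D2 l mD2 D2oo).
set X1 := \sum_(i <- r) \sum_(j <- r) fine (mu (A i `&` A j `&` D1)).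
set S1 := \sum_(i <- r) fine (mu (A i `&` D1)).
set X2 := \sum_(i <- r) \sum_(j <- r) fine (mu (A i `&` A j `&` D2)).
set S2 := \sum_(i <- r) fine (mu (A i `&` D2)).
have e1 : fine (mu (A i0 `&` A i0 `&` D)) = fine (mu D1) by rewrite setIid.
have e2 i : fine (mu (A i0 `&` A i `&` D)) = fine (mu (A i `&` D1)).
  by rewrite /D1 setIA [A i0 `&` _]setIC.
have e3 i : fine (mu (A i `&` A i0 `&` D)) = fine (mu (A i `&` D1)).
  by rewrite /D1 setIA.
have e4 : \sum_(i <- r) \sum_(j <- r) fine (mu (A i `&` A j `&` D)) = X1 + X2.
  rewrite -big_split; apply: eq_bigr => i _; rewrite -big_split.
  by apply: eq_bigr => j _; rewrite split_fine //; exact: measurableI.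
have e5 : \sum_(i <- r) fine (mu (A i `&` D)) = S1 + S2.
  by rewrite -big_split; apply: eq_bigr => i _; rewrite split_fine.
have e6 : \sum_(i <- r) \sum_(j <- i0 :: r) fine (mu (A i `&` A j `&` D)) =
    S1 + (X1 + X2).
  rewrite -e4 -big_split; apply: eq_bigr => i _.
  by rewrite big_cons e3.
have e7 : \sum_(j <- i0 :: r) fine (mu (A i0 `&` A j `&` D)) = fine (mu D1) + S1.
  by rewrite big_cons e1; congr (_ + _); apply: eq_bigr => j _; rewrite e2.
have e8 : fine (mu D) = fine (mu D1) + fine (mu D2).
  by have := split_fine setT measurableT; rewrite !setTI.
rewrite big_cons e7 e6 big_cons e5 -/D1 e8 => h.
by rewrite (le_trans h) // le_eqVlt; apply/orP; left; apply/eqP; ring.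
Qed.

Lemma sum_half_le {R : realType} (k K : nat) :
  \sum_(0 <= l < K) (if (k <= l)%N then (2 : R) ^- (l - k) else 0) <= 2.
Proof.
suff : \sum_(0 <= l < K) (if (k <= l)%N then (2 : R) ^- (l - k) else 0) <=
    2 - 2 * 2 ^- (K - k).
  by move=> h; apply: le_trans h _; rewrite lerBlDr lerDl mulr_ge0 // invr_ge0 exprn_ge0.
elim: K => [|K IH]; first by rewrite big_geq // sub0n expr0 invr1; lra.
rewrite big_nat_recr //=; apply: (le_trans (lerD IH (lexx _))).
case: ifPn => [kK|]; last first.
  rewrite -ltnNge => Kk.
  have -> : (K - k = 0)%N by apply/eqP; rewrite subn_eq0 ltnW.
  have -> : (K.+1 - k = 0)%N by apply/eqP; rewrite subn_eq0.
  by rewrite addr0.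
by rewrite subSn // exprS invfM; set w := _ ^- _; lra.
Qed.

Section boxes.
Context {R : realType} (n : nat).
Local Notation tup := (n.-tuple (measurableTypeR R)).
Local Notation mu := (@lebesgue_measure_n R n).

Definition box (x : 'I_n -> R) (r : R) : set tup :=
  [set t | forall u, `|tnth t u - x u| <= r].

Lemma boxE x r : box x r =
  [set t : tup | forall u, [set` `[x u - r, x u + r]] (tnth t u)].
Proof.
apply/seteqP; split => t /= h u; have := h u; rewrite in_itv /= ler_distl //.
Qed.

Lemma measurable_tuple_cube (B : 'I_n -> set (measurableTypeR R)) :
  (forall i, measurable (B i)) -> measurable [set t : tup | forall i, B i (tnth t i)].
Proof.
move=> mB; rewrite [X in measurable X](_ : _ =
    \bigcap_(i in [set: 'I_n]) ((@tnth _ _ ^~ i) @^-1` B i)).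
  apply: fin_bigcap_measurable => // i _.
  by rewrite -[X in measurable X]setTI; exact: measurable_tnth.
by apply/seteqP; split=> [t h i _|t h i]; [exact: h|exact: (h i)].
Qed.

Lemma measurable_box x r : measurable (box x r).
Proof.
rewrite boxE; apply: (measurable_tuple_cube (B := fun u => [set` `[x u - r, x u + r]])).
by move=> i; exact: measurable_itv.
Qed.

Lemma lebesgue_box x r : 0 <= r -> mu (box x r) = ((2 * r) ^+ n)%:E.
Proof.
move=> r0; rewrite boxE (lebesgue_measure_n_box (B := fun u => [set` `[x u - r, x u + r]]));
  last by move=> i; exact: measurable_itv.
rewrite (eq_bigr (fun=> (2 * r)%:E)); last first.
  move=> i _; rewrite lebesgue_measure_itv /= lte_fin.
  case: ifPn => [_|]; first by rewrite -EFinB; congr (_%:E); ring.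
  by rewrite -leNgt => h; congr (_%:E); lra.
by rewrite prodEFin prodr_const card_ord.
Qed.

Lemma box_meet x y r r' : box x r `&` box y r' !=set0 ->
  forall u, `|y u - x u| <= r + r'.
Proof.
move=> [t [h1 h2]] u; rewrite -(subrKA (tnth t u)) (le_trans (ler_normD _ _)) //.
by rewrite addrC; apply: lerD => //; rewrite distrC.
Qed.

Section levels.
Variables (h c1 : R) (K : nat) (X : nat -> seq {ffun 'I_n -> R}) (r s : nat -> R).
Variable E : set tup.
Hypotheses (h0 : 0 < h) (c10 : 0 < c1) (n0 : (0 < n)%N).
Hypotheses (r0 : forall k, 0 < r k) (s0 : forall k, 0 < s k).
Hypothesis r_half : forall k l, (k <= l)%N -> r l <= r k * 2 ^- (l - k).
Hypothesis X_near : forall k (y : 'I_n -> R) rho, 0 <= rho ->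
  (count (fun x : {ffun 'I_n -> R} => [forall u, `|x u - y u| <= rho]) (X k))%:R
    <= (2 * rho / s k + 3) ^+ n.
Hypothesis X_size : forall k, X k != [::] -> c1 * h ^+ n <= (size (X k))%:R * s k ^+ n.
Hypotheses (mE : measurable E) (Eoo : (mu E < +oo)%E).
Hypothesis XE : forall k x, x \in X k -> box x (r k) `<=` E.

Let v k := (2 * r k) ^+ n.
Let S := \sum_(0 <= k < K) (size (X k))%:R * v k.
Let pairs k l := \sum_(x <- X k) \sum_(y <- X l)
  fine (mu (box x (r k) `&` box y (r l) `&` E)).

Let v0 k : 0 <= v k.
Proof. by rewrite exprn_ge0 // mulr_ge0 // ltW. Qed.

(** A box of level [l] meets the box of [x] at level [k] only if its centre is within [2 r_k] of
    [x], and [X_near] counts these centres by [(4 r_k / s_l + 3)^n]. The first summand yields what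
    independence would give, as [s_l^(-n) <= size (X l) / (c1 h^n)]; the 3 yields the near-diagonal
    term, which decays with [l - k] as the volumes do. *)
Let pairs_le k l : (k <= l)%N -> pairs k l <=
  4 ^+ n / (c1 * h ^+ n) * ((size (X k))%:R * v k) * ((size (X l))%:R * v l) +
  6 ^+ n * ((size (X k))%:R * v k) * 2 ^- (l - k).
Proof.
move=> kl; have hn : 0 < h ^+ n by rewrite exprn_gt0.
have rhs0 : 0 <= 4 ^+ n / (c1 * h ^+ n) * ((size (X k))%:R * v k) * ((size (X l))%:R * v l) +
  6 ^+ n * ((size (X k))%:R * v k) * 2 ^- (l - k).
  have Ik k' : 0 <= (size (X k'))%:R * v k' by apply: mulr_ge0.
  have q1 : 0 <= 4 ^+ n / (c1 * h ^+ n).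
    by apply: divr_ge0; [rewrite exprn_ge0|exact: ltW (mulr_gt0 c10 hn)].
  have q2 : 0 <= 6 ^+ n :> R by rewrite exprn_ge0.
  have q3 : 0 <= 2 ^- (l - k) :> R by rewrite invr_ge0 exprn_ge0.
  exact: (addr_ge0 (mulr_ge0 (mulr_ge0 q1 (Ik k)) (Ik l))
    (mulr_ge0 (mulr_ge0 q2 (Ik k)) q3)).
have [Xl|Xl] := eqVneq (X l) [::].
  have -> : pairs k l = 0 by rewrite /pairs Xl big1 // => x _; rewrite big_nil.
  exact: rhs0.
have sl : s l ^- n <= (size (X l))%:R / (c1 * h ^+ n).
  rewrite ler_pdivlMr ?mulr_gt0 // mulrC ler_pdivrMr ?exprn_gt0 //.
  exact: X_size.
have rl : r l <= r k.
  apply: le_trans (r_half kl) _; rewrite ler_piMr ?(ltW (r0 k)) //.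
  by rewrite invf_le1 ?exprn_gt0 // exprn_ege1 // ler1n.
have vl : v l <= v k * 2 ^- (l - k).
  apply: (@le_trans _ _ ((2 * (r k * 2 ^- (l - k))) ^+ n)).
    by rewrite lerXn2r ?nnegrE ?mulr_ge0 ?invr_ge0 ?exprn_ge0 ?(ltW (r0 _)) // ler_pM2l // r_half.
  rewrite mulrA exprMn (ler_wpM2l (v0 k)) // ler_iXnr // ?invr_ge0 ?exprn_ge0 //.
  by rewrite invf_le1 ?exprn_gt0 // exprn_ege1 // ler1n.
have one x : \sum_(y <- X l) fine (mu (box x (r k) `&` box y (r l) `&` E)) <=
    (4 ^+ n * v k * s l ^- n + 6 ^+ n) * v l.
  apply: (@le_trans _ _ (\sum_(y <- X l | [forall u, `|y u - x u| <= 2 * r k]) v l)).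
    rewrite [leRHS]big_mkcond /=; apply: ler_sum => y _; case: ifPn => [_|hy].
      rewrite -[leRHS]/(fine (v l)%:E) -(lebesgue_box y (ltW (r0 l))) fine_le //.
      { rewrite ge0_fin_numE //; apply: le_lt_trans Eoo; apply: le_measure; rewrite ?inE //.
        by apply: measurableI => //; apply: measurableI; exact: measurable_box. }
      { by rewrite lebesgue_box // ltW. }
      apply: le_measure; rewrite ?inE //; first last.
      { by move=> t [[]]. }
      { exact: measurable_box. }
      by apply: measurableI => //; apply: measurableI; exact: measurable_box.
    rewrite (_ : _ `&` E = set0) ?measure0 //.
    apply/seteqP; split => // t [ht _]; move/negP: hy; apply.
    apply/forallP => u; have := @box_meet x y (r k) (r l) _ u; move/(_ (ex_intro _ t ht)).
    by move=> /le_trans; apply; rewrite mulr_natl mulr2n lerD2l.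
  rewrite big_const_seq iter_addr_0 -[leLHS]mulr_natr mulrC ler_wpM2r //.
  apply: le_trans (X_near l x _) _; first by rewrite mulr_ge0 // ltW.
  have -> : 4 ^+ n * v k * s l ^- n = 2 ^+ n * (4 * r k / s l) ^+ n.
    by rewrite /v -exprVn -!exprMn; congr (_ ^+ n); field; rewrite gt_eqF.
  have -> : 6 ^+ n = 2 ^+ n * 3 ^+ n :> R by rewrite -exprMn; congr (_ ^+ n); ring.
  have -> : 2 * (2 * r k) / s l = 4 * r k / s l by ring.
  set z := 4 * r k / s l; have z0 : 0 <= z by rewrite divr_ge0 ?mulr_ge0 // ltW.
  clearbody z.
  (* Comparing [z] with 3 gives [(z + 3)^n <= 2^n z^n + 6^n]. *)
  have [z3|z3] := leP z 3.
    apply: ler_wpDl; first by rewrite mulr_ge0 ?exprn_ge0.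
    by rewrite -exprMn lerXn2r ?nnegrE ?addr_ge0 //; lra.
  apply: ler_wpDr; first by rewrite mulr_ge0 ?exprn_ge0.
  by rewrite -exprMn lerXn2r ?nnegrE ?addr_ge0 ?mulr_ge0 //; lra.
apply: (@le_trans _ _ (\sum_(x <- X k) (4 ^+ n * v k * s l ^- n + 6 ^+ n) * v l)).
  by apply: ler_sum => x _; exact: one.
rewrite big_const_seq iter_addr_0 count_predT -[leLHS]mulr_natr mulrC mulrDl mulrDr.
have N0 : 0 <= (size (X k))%:R :> R by [].
apply: lerD.
  have := ler_wpM2l (mulr_ge0 (mulr_ge0 N0 (mulr_ge0 (exprn_ge0 n (ler0n R 4)) (v0 k))) (v0 l)) sl.
  set a := _ ^- n; set b := (c1 * _)^-1; lra.
have := ler_wpM2l (mulr_ge0 N0 (exprn_ge0 n (ler0n R 6))) vl.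
set a := _ ^- (l - k); lra.
Qed.

(** The pair sum is at most [(4^n / c1) S^2 / h^n + 4 * 6^n S], and [h^n <= S] turns the linear term
    into a quadratic one, so levels may be added freely until [S] reaches [h^n]. The second moment
    inequality at [l = w S / h^n] then reduces to [h^n <= w mu(E)]. *)
Lemma measure_levels : h ^+ n <= S ->
  h ^+ n / (4 ^+ n / c1 + 4 * 6 ^+ n) <= fine (mu E).
Proof.
move=> hS; have hn : 0 < h ^+ n by rewrite exprn_gt0.
set w := 4 ^+ n / c1 + _.
have w0 : 0 < w by rewrite addr_gt0 ?mulr_gt0 ?invr_gt0 ?exprn_gt0.
have S0 : 0 < S by apply: lt_le_trans hS.
pose I k := (size (X k))%:R * v k.
have I0 k : 0 <= I k by rewrite mulr_ge0.
pose idx := [seq (k, x) | k <- index_iota 0 K, x <- X k].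
pose A (i : nat * {ffun 'I_n -> R}) := box i.2 (r i.1).
have := @second_moment _ _ R mu _ A idx E (w * S / h ^+ n)
  (fun i => measurable_box _ _) mE Eoo.
have -> : \sum_(i <- idx) fine (mu (A i `&` E)) = S.
  rewrite big_allpairs_dep /=; apply: eq_bigr => k _.
  rewrite big_seq (eq_bigr (fun=> v k)).
    by rewrite -big_seq big_const_seq iter_addr_0 count_predT [RHS]mulr_natl.
  move=> x xk; rewrite /A /= (setIidl (XE xk)) lebesgue_box //; exact: ltW.
have PI : \sum_(i <- idx) \sum_(j <- idx) fine (mu (A i `&` A j `&` E)) <=
    w * S ^+ 2 / h ^+ n.
  have -> : \sum_(i <- idx) \sum_(j <- idx) fine (mu (A i `&` A j `&` E)) =
      \sum_(0 <= k < K) \sum_(0 <= l < K) pairs k l.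
    rewrite big_allpairs_dep /=; apply: eq_bigr => k _.
    rewrite /pairs [RHS]exchange_big /=; apply: eq_bigr => x _.
    by rewrite big_allpairs_dep.
  have pairsC k l : pairs k l = pairs l k.
    rewrite /pairs exchange_big /=; apply: eq_bigr => y _; apply: eq_bigr => x _.
    by rewrite [box x _ `&` _]setIC.
  pose g k l : R := if (k <= l)%N then 2 ^- (l - k) else 0.
  have g0 k l : 0 <= g k l by rewrite /g; case: ifP => // _; rewrite invr_ge0 exprn_ge0.
  have t0 k l : 0 <= 6 ^+ n * (I k * g k l).
    by apply: mulr_ge0; [rewrite exprn_ge0|exact: mulr_ge0].
  have hp k l : pairs k l <= 4 ^+ n / (c1 * h ^+ n) * I k * I l +
      6 ^+ n * (I k * g k l) + 6 ^+ n * (I l * g l k).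
    have [kl|lk] := leqP k l.
      apply: ler_wpDr; first exact: t0.
      by apply: le_trans (pairs_le kl) _; rewrite /g kl lerD2l [leRHS]mulrA.
    rewrite addrAC; apply: ler_wpDr; first exact: t0.
    rewrite pairsC; apply: le_trans (pairs_le (ltnW lk)) _.
    rewrite /g (ltnW lk) le_eqVlt; apply/orP; left; apply/eqP.
    by rewrite -/(I l) -/(I k); ring.
  apply: (@le_trans _ _ (4 ^+ n / (c1 * h ^+ n) * S * S + 4 * 6 ^+ n * S)).
    apply: le_trans (ler_sum _ (fun k _ => ler_sum _ (fun l _ => hp k l))) _.
    under eq_bigr => k _ do rewrite !big_split /=.
    rewrite !big_split /= -addrA; apply: lerD.
      rewrite le_eqVlt; apply/orP; left; apply/eqP.
      under eq_bigr => k _ do rewrite -mulr_sumr.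
      by rewrite -mulr_suml -mulr_sumr.
    have -> : \sum_(0 <= k < K) \sum_(0 <= l < K) 6 ^+ n * (I l * g l k) =
       \sum_(0 <= k < K) \sum_(0 <= l < K) 6 ^+ n * (I k * g k l).
      by rewrite exchange_big.
    have : \sum_(0 <= k < K) \sum_(0 <= l < K) 6 ^+ n * (I k * g k l) <= 2 * 6 ^+ n * S.
      rewrite /S mulr_sumr; apply: ler_sum => k _.
      rewrite -mulr_sumr -mulr_sumr -/(I k).
      have := ler_wpM2l (mulr_ge0 (exprn_ge0 n (ler0n R 6)) (I0 k)) (@sum_half_le R k K).
      by rewrite -mulrA; lra.
    lra.
  have -> : w * S ^+ 2 / h ^+ n = 4 ^+ n / (c1 * h ^+ n) * S * S + 4 * 6 ^+ n * (S * S / h ^+ n).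
    by rewrite /w; field; rewrite !gt_eqF.
  rewrite lerD2l ler_wpM2l ?mulr_ge0 ?exprn_ge0 //.
  by rewrite ler_pdivlMr // ler_wpM2l // ltW.
set P := \sum_(i <- idx) _ in PI *; set M := fine _ => h1.
have h2 : w * S ^+ 2 / h ^+ n <= (w * S / h ^+ n) ^+ 2 * M.
  have e : 2 * (w * S / h ^+ n) * S = 2 * (w * S ^+ 2 / h ^+ n) by ring.
  by move: h1; rewrite e; lra.
have f0 : 0 < w * S ^+ 2 / h ^+ n by rewrite divr_gt0 ?mulr_gt0 ?exprn_gt0.
rewrite ler_pdivrMr // -(ler_pM2r f0).
have := ler_wpM2l (ltW hn) h2.
have -> : h ^+ n * ((w * S / h ^+ n) ^+ 2 * M) = M * w * (w * S ^+ 2 / h ^+ n).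
  by field; rewrite gt_eqF.
by [].
Qed.

End levels.
End boxes.

(** * A density theorem for dyadic cells *)

Section dyadic_density.
Context {R : realType} (n : nat).
Local Notation tup := (n.-tuple (measurableTypeR R)).
Local Notation mu := (@lebesgue_measure_n R n).

Definition dyadic (N : nat) (t : tup) : {ffun 'I_n -> int} :=
  [ffun u => Num.floor (2 ^+ N * tnth t u : R)].

Definition cell N z : set tup := [set t | dyadic N t = z].

Lemma cellE N z : cell N z = [set t : tup | forall u,
  [set` `[(z u)%:~R / 2 ^+ N : R, ((z u)%:~R + 1) / 2 ^+ N[] (tnth t u)].
Proof.
have N0 : 0 < 2 ^+ N :> R by rewrite exprn_gt0.
have e (t : tup) u : [set` `[(z u)%:~R / 2 ^+ N : R, ((z u)%:~R + 1) / 2 ^+ N[]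
    (tnth t u) <-> Num.floor (2 ^+ N * tnth t u : R) = z u.
  rewrite /= in_itv /= ler_pdivrMr // ltr_pdivlMr // mulrC -intrD1 -floor_eq.
  by split=> [/eqP|->].
apply/seteqP; split => t /=.
- by move=> /ffunP h u; apply/e; have := h u; rewrite ffunE.
- by move=> h; apply/ffunP => u; rewrite ffunE; exact: (proj1 (e t u) (h u)).
Qed.

Lemma measurable_cell N z : measurable (cell N z).
Proof.
rewrite cellE; apply: (measurable_tuple_cube (B := fun u =>
  [set` `[(z u)%:~R / 2 ^+ N : R, ((z u)%:~R + 1) / 2 ^+ N[])).
by move=> i; exact: measurable_itv.
Qed.

Lemma lebesgue_cell N z : mu (cell N z) = ((2 ^- N) ^+ n)%:E.
Proof.
rewrite cellE (lebesgue_measure_n_box (B := fun u =>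
  [set` `[(z u)%:~R / 2 ^+ N : R, ((z u)%:~R + 1) / 2 ^+ N[]));
  last by move=> i; exact: measurable_itv.
rewrite (eq_bigr (fun=> (2 ^- N)%:E)); last first.
  move=> u _; rewrite lebesgue_measure_itv /= lte_fin.
  rewrite ltr_pM2r ?invr_gt0 ?exprn_gt0 // ltrDl ltr01 -EFinB; congr (_%:E).
  by rewrite mulrDl mul1r addrAC subrr add0r.
by rewrite prodEFin prodr_const card_ord.
Qed.

(** Measurable unions of cells of generation [N], phrased as invariance under equality of indices,
    which makes Boolean operations immediate. *)
Definition level N (D : set tup) :=
  measurable D /\ forall t t', dyadic N t = dyadic N t' -> D t -> D t'.

Lemma dyadic_le N N' t t' : (N <= N')%N -> dyadic N' t = dyadic N' t' ->
  dyadic N t = dyadic N t'.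
Proof.
move=> NN /ffunP h; apply/ffunP => u; have := h u; rewrite !ffunE => hu.
(* Comparing a floor with an integer passes to the finer scale by multiplying the integer by a power
   of 2. *)
have key (x : R) (k : int) : (k <= Num.floor (2 ^+ N * x)) =
    (2 ^+ (N' - N) * k <= Num.floor (2 ^+ N' * x)).
  rewrite !floor_ge_int -{2}(subnK NN) exprD rmorphM rmorphXn /= -mulrA.
  by rewrite ler_pM2l // exprn_gt0.
apply/eqP; rewrite eq_le; apply/andP; split.
- by rewrite key -hu -key.
- by rewrite key hu -key.
Qed.

Lemma level_le N N' D : (N <= N')%N -> level N D -> level N' D.
Proof.
by move=> NN [mD hD]; split => // t t' /(dyadic_le NN); exact: hD.
Qed.

Lemma levelC N D : level N D -> level N (~` D).
Proof.
by move=> [mD hD]; split; [exact: measurableC|move=> t t' e nD Dt; apply/nD/(hD t')].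
Qed.

Lemma levelU N D D' : level N D -> level N D' -> level N (D `|` D').
Proof.
move=> [mD hD] [mD' hD']; split; first exact: measurableU.
by move=> t t' e [/(hD _ _ e)|/(hD' _ _ e)]; [left|right].
Qed.

Lemma levelI N D D' : level N D -> level N D' -> level N (D `&` D').
Proof.
move=> [mD hD] [mD' hD']; split; first exact: measurableI.
by move=> t t' e [/(hD _ _ e) ? /(hD' _ _ e)].
Qed.

Let piece N (D : set tup) (i : nat) : set tup :=
  [set t | D t /\ pickle (dyadic N t) = i].

Let pieceP N D i : level N D -> piece N D i = set0 \/ exists z, piece N D i = cell N z.
Proof.
move=> [mD hD]; have [[t [Dt ti]]|h] := pselect (exists t, piece N D i t).
  right; exists (dyadic N t); apply/seteqP; split => t' /=.
    by move=> [_ ti']; apply: (pcan_inj pickleK); rewrite ti'.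
  by move=> e; split; [exact: hD Dt|rewrite /= e].
by left; apply/seteqP; split => // t ht; apply: h; exists t.
Qed.

Let piece_cover N D : D = \bigcup_i piece N D i.
Proof.
apply/seteqP; split => [t Dt|t [i _ []] //].
by exists (pickle (dyadic N t)).
Qed.

Let trivIset_piece N D : trivIset setT (piece N D).
Proof. by move=> i j _ _ [t [[_ <-] [_ <-]]]. Qed.

Let measurable_piece N D i : level N D -> measurable (piece N D i).
Proof. by move=> /(@pieceP _ _ i)[->|[z ->]] //; exact: measurable_cell. Qed.

Variables (E : set tup) (c : R).
Hypotheses (mE : measurable E) (c0 : 0 < c) (c1 : c <= 1).
Hypothesis E_dense : forall N z, (c%:E * mu (cell N z) <= mu (E `&` cell N z))%E.

Let cell_diff N z : (mu (cell N z `\` E) <= (1 - c)%:E * mu (cell N z))%E.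
Proof.
have := E_dense N z; have mc := measurable_cell N z.
have cf : (mu (cell N z) < +oo)%E by rewrite lebesgue_cell ltry.
have -> : mu (cell N z `\` E) = (mu (cell N z) - mu (cell N z `&` E))%E.
  exact: (measureD mc mE cf).
rewrite setIC lebesgue_cell; set w := _ ^+ n.
have : (mu (cell N z `&` E) \is a fin_num)%E.
  rewrite ge0_fin_numE //; apply: le_lt_trans (_ : mu (cell N z) < +oo)%E.
    by apply: le_measure; rewrite ?inE; [exact: measurableI|exact: mc|exact: subIsetl].
  by rewrite lebesgue_cell ltry.
case: (mu _) => // r _; rewrite -EFinM lee_fin -EFinB -EFinM lee_fin => h.
by rewrite mulrBl mul1r lerD2l lerN2.
Qed.

Let level_diff N D : level N D -> (mu (D `\` E) <= (1 - c)%:E * mu D)%E.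
Proof.
move=> lD; have mp i := measurable_piece i lD.
rewrite [in leRHS](piece_cover N D) {1}(piece_cover N D) setDE setI_bigcupl.
rewrite measure_bigcup; first last.
{ by apply: trivIset_setIr; exact: trivIset_piece. }
{ by move=> i _; apply: measurableI => //; exact: measurableC. }
have -> : mu (\bigcup_i piece N D i) =
    (\sum_(0 <= i <oo | i \in [set: nat]) mu (piece N D i))%E.
  exact: (measure_bigcup _ _ _ (fun i _ => mp i) (@trivIset_piece N D)).
rewrite -nneseriesZl //; apply: lee_nneseries => // i _.
have [->|[z ->]] := pieceP i lD; last by rewrite -setDE; exact: cell_diff.
by rewrite set0I !measure0 mule0.
Qed.

Section unit_cell.
Variable z0 : {ffun 'I_n -> int}.
Let U := cell 0 z0.
Let mU : measurable U. Proof. exact: measurable_cell. Qed.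

Let mu_U (A : set tup) : R := fine (mu (A `&` U)).

Let fin_U A : measurable A -> mu (A `&` U) \is a fin_num.
Proof.
move=> mA; rewrite ge0_fin_numE //; apply: le_lt_trans (_ : mu U < +oo)%E.
  by apply: le_measure; rewrite ?inE; [exact: measurableI|exact: mU|exact: subIsetr].
by rewrite lebesgue_cell ltry.
Qed.

Let mu_U_ge0 A : 0 <= mu_U A. Proof. exact: fine_ge0. Qed.

Let mu_U_le A B : measurable A -> measurable B -> A `<=` B -> mu_U A <= mu_U B.
Proof.
move=> mA mB AB; apply: fine_le; [exact: fin_U|exact: fin_U|].
apply: le_measure; rewrite ?inE; [| |exact: setSI].
  by apply: measurableI => //; exact: measurable_cell.
by apply: measurableI => //; exact: measurable_cell.
Qed.

Let mu_U_setU A B : measurable A -> measurable B -> mu_U (A `|` B) <= mu_U A + mu_U B.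
Proof.
move=> mA mB; rewrite /mu_U -fineD ?fin_U //; apply: fine_le.
- by apply: fin_U; exact: measurableU.
- by rewrite fin_numD !fin_U.
- by rewrite setIUl; apply: measureU2; apply: measurableI => //; exact: measurable_cell.
Qed.

Let dist (A D : set tup) := (A `\` D) `|` (D `\` A).

Let mdist A D : measurable A -> measurable D -> measurable (dist A D).
Proof. by move=> mA mD; apply: measurableU; exact: measurableD. Qed.

(** Approximable in measure, inside the unit cell [U], by level sets of some generation. These sets
    form a sigma-algebra containing the coordinate half-spaces, hence all measurable sets; this
    stands in for Lebesgue's density theorem. *)
Let approx (A : set tup) := measurable A /\
  forall e : R, 0 < e -> exists N, exists2 D, level N D & mu_U (dist A D) <= e.

Let approx_level N D : level N D -> approx D.
Proof.
move=> lD; split; first by case: lD.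
move=> e e0; exists N, D => //; rewrite /dist setDv setU0 /mu_U set0I measure0 /=.
exact: ltW.
Qed.

Let approxC A : approx A -> approx (~` A).
Proof.
move=> [mA hA]; split; first exact: measurableC.
move=> e /hA[N [D lD h]]; exists N, (~` D); first exact: levelC.
by rewrite /dist !setDE !setCK [~` A `&` _]setIC [~` D `&` _]setIC setUC.
Qed.

Let dist_triangle A B D : dist A D `<=` dist A B `|` dist B D.
Proof.
move=> t [[At Dt]|[Dt At]]; have [Bt|Bt] := pselect (B t).
- by right; left.
- by left; left.
- by left; right.
- by right; right.
Qed.

Let mu_U_dist A B D : measurable A -> measurable B -> measurable D ->
  mu_U (dist A D) <= mu_U (dist A B) + mu_U (dist B D).
Proof.
move=> mA mB mD; apply: le_trans (mu_U_setU (mdist mA mB) (mdist mB mD)).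
by apply: mu_U_le; [exact: mdist|apply: measurableU; exact: mdist|exact: dist_triangle].
Qed.

Let approxU A B : approx A -> approx B -> approx (A `|` B).
Proof.
move=> [mA hA] [mB hB]; split; first exact: measurableU.
move=> e e0; have e2 : 0 < e / 2 by rewrite divr_gt0.
have [N [D lD hD]] := hA _ e2; have [N' [D' lD' hD']] := hB _ e2.
have [mD _] := lD; have [mD' _] := lD'.
exists (maxn N N'), (D `|` D').
  by apply: levelU; [apply: level_le lD|apply: level_le lD']; rewrite ?leq_maxl ?leq_maxr.
apply: (@le_trans _ _ (mu_U (dist A D `|` dist B D'))).
  apply: mu_U_le; [by apply: mdist; exact: measurableU| |].
    by apply: measurableU; exact: mdist.
  move=> t [[[At|Bt] nD]|[[Dt|Dt] nA]].
  { by left; left; split=> // Dt; apply: nD; left. }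
  { by right; left; split=> // Dt; apply: nD; right. }
  { by left; right; split=> // At; apply: nA; left. }
  by right; right; split=> // Bt; apply: nA; right.
apply: le_trans (mu_U_setU (mdist mA mD) (mdist mB mD')) _.
by rewrite [e]splitr; exact: lerD.
Qed.

(** Finite unions exhaust the countable one up to small measure, by continuity from above inside
    [U], whose measure is finite. *)
Let approx_bigcup (F : nat -> set tup) : (forall i, approx (F i)) ->
  approx (\bigcup_i F i).
Proof.
move=> hF; have mF i : measurable (F i) by case: (hF i).
pose G k := \big[setU/set0]_(i < k) F i.
have aG k : approx (G k).
  rewrite /G; elim: k => [|k IH].
    by rewrite big_ord0; apply: (@approx_level 0); split.
  by rewrite big_ord_recr; exact: approxU.
have mG k : measurable (G k) by case: (aG k).
set A := \bigcup_i F i; have mA : measurable A by exact: bigcup_measurable.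
split=> // e e0; have e2 : 0 < e / 2 by rewrite divr_gt0.
pose H k := (A `\` G k) `&` U.
have mH k : measurable (H k).
  by apply: measurableI; [exact: measurableD|exact: measurable_cell].
have H0 : \bigcap_k H k = set0.
  apply/seteqP; split => // t h; have [[[i _ Fit] _] _] := h 0%N I.
  have [[_ nG] _] := h i.+1 I; apply: nG.
  exact: (@bigsetU_sup _ i i.+1).
have : (mu \o H) k @[k --> \oo] --> mu (\bigcap_k H k).
  apply: nonincreasing_cvg_mu => //.
  { apply: le_lt_trans (_ : mu U < +oo)%E; last by rewrite lebesgue_cell ltry.
    by apply: le_measure; rewrite ?inE; [exact: mH|exact: mU|exact: subIsetr]. }
  { by rewrite H0. }
  move=> k l kl; apply/subsetPset => t [[At nG] Ut]; split=> //; split=> // Gt.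
  by apply: nG; apply: subset_bigsetU Gt.
rewrite H0 measure0 => /fine_cvgP[_ /cvgrPdist_le /(_ _ e2)[k _ hk]].
have {}hk : mu_U (A `\` G k) <= e / 2.
  have := hk k (leqnn k); rewrite /= sub0r normrN ger0_norm //.
  exact: fine_ge0.
have [N [D lD hD]] := (aG k).2 _ e2; exists N, D => //.
have [mD _] := lD.
apply: le_trans (mu_U_dist mA (mG k) mD) _.
rewrite [e]splitr; apply: lerD => //.
apply: le_trans hk; apply: mu_U_le; [exact: mdist|exact: measurableD|].
move=> t [//|[Gt nA]]; exfalso; apply: nA.
exact: (bigsetU_bigcup Gt).
Qed.

Let approx_sigma : sigma_algebra setT approx.
Proof.
split.
- by apply: (@approx_level 0); split.
- by move=> A; rewrite setTD; exact: approxC.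
- exact: approx_bigcup.
Qed.

Let approx_coord (u : 'I_n) (Y : set (measurableTypeR R)) : measurable Y ->
  approx ((fun t : tup => tnth t u) @^-1` Y).
Proof.
pose f := fun t : tup => tnth t u.
have mf : measurable_fun setT f by exact: measurable_tnth.
have sg : sigma_algebra setT [set Y : set R | approx (f @^-1` Y)].
  split.
  { by rewrite /= preimage_set0; case: approx_sigma. }
  { by move=> B hB; rewrite /= setTD preimage_setC; exact: approxC. }
  by move=> F hF; rewrite /= preimage_bigcup; exact: approx_bigcup.
(* [x < t_u] holds iff [x < k / 2^N <= t_u] for some [N] and integer [k], and the least candidate is
   [k = floor(2^N x) + 1]. For fixed [N] the condition on [t] depends only on its index. *)
have ray (x : R) : approx (f @^-1` `]x, +oo[).
  have -> : f @^-1` `]x, +oo[ =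
      \bigcup_N [set t : tup | (Num.floor (2 ^+ N * x) + 1)%:~R <= 2 ^+ N * tnth t u].
    apply/seteqP; split => t /=.
    { rewrite in_itv /= andbT => xt.
      have d0 : 0 < tnth t u - x by rewrite subr_gt0.
      pose N := (Num.truncn (1 / (tnth t u - x))).+1; exists N => //=.
      have : 1 <= 2 ^+ N * (tnth t u - x).
        rewrite -ler_pdivrMr //; apply: (@le_trans _ _ N%:R).
          exact/ltW/truncnS_gt.
        by rewrite -natrX ler_nat ltnW // ltn_expl.
      have := floor_le (2 ^+ N * x); rewrite rmorphD /=.
      set w := 2 ^+ N; lra. }
    move=> [N _ /=]; rewrite in_itv /= andbT => h.
      have /andP[_] := floor_itv (2 ^+ N * x).
      by move=> /lt_le_trans /(_ h); rewrite ltr_pM2l // exprn_gt0.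
  apply: approx_bigcup => N; apply: (@approx_level N); split.
    have -> : [set t : tup | (Num.floor (2 ^+ N * x) + 1)%:~R <= 2 ^+ N * tnth t u] =
       f @^-1` `[(Num.floor (2 ^+ N * x) + 1)%:~R / 2 ^+ N, +oo[.
      apply/seteqP; split => t /=.
      { by move=> h; rewrite in_itv /= andbT ler_pdivrMr ?exprn_gt0 // [f t * _]mulrC. }
      by rewrite in_itv /= andbT ler_pdivrMr ?exprn_gt0 // [f t * _]mulrC.
    by rewrite -[X in measurable X]setTI; apply: mf => //; exact: measurable_itv.
  move=> t t' /ffunP /(_ u); rewrite !ffunE /= => e.
  by rewrite -!floor_ge_int e.
rewrite measurable_realfun.RGenOInfty.measurableE => mY.
by apply: (smallest_sub sg _ mY) => B [x ->]; exact: ray.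
Qed.

Let approx_measurable (A : set tup) : measurable A -> approx A.
Proof.
apply: smallest_sub; first exact: approx_sigma.
rewrite -bigcup_seq /= => B [u _ [Y mY <-]]; rewrite setTI.
exact: approx_coord.
Qed.

(** Let [x] be the measure of the complement of [E] in [U], and [y] its distance to a level set [D].
    The density hypothesis on [D] gives [x <= (1 - c)(x + y) + y], so [c x <= 2 y], with [y]
    arbitrarily small. *)
Let null_unit : mu_U (~` E) = 0.
Proof.
apply/eqP; rewrite eq_le mu_U_ge0 andbT.
apply/ler_addgt0Pr => e e0; rewrite add0r.
have mB : measurable (~` E) by exact: measurableC.
have e2 : 0 < c * e / 2 by rewrite divr_gt0 // mulr_gt0.
have [N [D lD hD]] := (approx_measurable mB).2 _ e2.
have [mD _] := lD.
have lDU : level N (D `&` U).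
  apply: levelI => //; apply: (@level_le 0) => //; split; first exact: measurable_cell.
  by move=> t t' ee; rewrite /U /cell /= -ee.
have h1 : mu_U (D `\` E) <= (1 - c) * mu_U D.
  have := level_diff lDU.
  have -> : (D `&` U) `\` E = (D `\` E) `&` U by rewrite !setDE setIAC.
  move=> h.
  have f1 : mu ((D `\` E) `&` U) \is a fin_num by apply: fin_U; exact: measurableD.
  have f2 : ((1 - c)%:E * mu (D `&` U))%E \is a fin_num by rewrite fin_numM // fin_U.
  by have := fine_le f1 f2 h; rewrite fineM // fin_U.
have h2 : mu_U (~` E) <= mu_U (D `\` E) + mu_U (dist (~` E) D).
  apply: le_trans (mu_U_setU (measurableD mD mE) (mdist mB mD)).
  apply: mu_U_le => //; first by apply: measurableU; [exact: measurableD|exact: mdist].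
  by move=> t Et; have [Dt|Dt] := pselect (D t); [left|right; left].
have h3 : mu_U D <= mu_U (~` E) + mu_U (dist (~` E) D).
  apply: le_trans (mu_U_setU mB (mdist mB mD)).
  apply: mu_U_le => //; first by apply: measurableU => //; exact: mdist.
  by move=> t Dt; have [Et|Et] := pselect ((~` E) t); [left|right; right].
have c1' : 0 <= 1 - c by rewrite subr_ge0.
have h4 := ler_wpM2l c1' h3.
rewrite -(ler_pM2l c0).
have := mu_U_ge0 (dist (~` E) D).
move: h1 h2 h4 hD; set x := mu_U (~` E); set y := mu_U (dist _ _).
set v := mu_U D; set w := mu_U (D `\` E) => h1 h2 h4 hD y0.
have : c * y <= y by rewrite ler_piMl.
nra.
Qed.

Lemma null_in_unit_cell : mu (~` E `&` U) = 0%E.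
Proof.
have := null_unit; rewrite /mu_U => h.
by rewrite -[LHS]fineK ?h // fin_U //; exact: measurableC.
Qed.

End unit_cell.

Lemma density_negligible : mu.-negligible (~` E).
Proof.
have lB : measurable (~` E) by exact: measurableC.
have mT : level 0 setT by split.
have -> : ~` E = \bigcup_i (~` E `&` piece 0 setT i).
  by rewrite -setI_bigcupr -piece_cover setIT.
apply: negligible_bigcup => i; apply/negligibleP.
  by apply: measurableI => //; exact: measurable_piece.
have [->|[z ->]] := pieceP i mT; first by rewrite setI0 measure0.
exact: null_in_unit_cell.
Qed.

End dyadic_density.

(** * From the multiplicative condition to separation *)

Section distances.
Context {R : realType}.

Lemma mx_norm_le k l (y : 'M[R]_(k, l)) (b : R) : 0 <= b ->
  (forall i j, `|y i j| <= b) -> `|y| <= b.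
Proof.
move=> b0 h; rewrite [`|y|]mx_normrE.
by apply: bigmax_le => // -[i j] _; exact: h.
Qed.

Let dist_int_set k (y : 'rV[R]_k) :=
  [set `|y - map_mx intr z| | z in [set: 'rV[int]_k]].

Let dist_int_lb k (y : 'rV[R]_k) : lbound (dist_int_set y) 0.
Proof. by move=> _ [z _ <-]. Qed.

Lemma dist_int_ge0 k (y : 'rV[R]_k) : 0 <= dist_int y.
Proof.
apply: lb_le_inf; last exact: dist_int_lb.
by exists `|y - map_mx intr (0 : 'rV_k)|, 0.
Qed.

Lemma dist_int_le k (y : 'rV[R]_k) (z : 'rV[int]_k) (b : R) : 0 <= b ->
  (forall i, `|y 0 i - (z 0 i)%:~R| <= b) -> dist_int y <= b.
Proof.
move=> b0 h; apply: (@le_trans _ _ `|y - map_mx intr z|).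
  by apply: ge_inf; [exists 0; exact: dist_int_lb|exists z].
by apply: mx_norm_le => // i j; rewrite (ord1 i) !mxE; exact: h.
Qed.

Lemma MAD_bound m l (w : R) (b : 'M[R]_(m, l)) : MAD w b ->
  exists2 c : R, 0 < c & forall j : 'rV[int]_l, j != 0 -> c <= mult_form w b j.
Proof.
rewrite /MAD; set v := ereal_inf _ => v0.
have [c c0 cv] : exists2 c : R, 0 < c & (c%:E <= v)%E.
  move: v v0 => [r| |] //; first by rewrite lte_fin => r0; exists r.
  by exists 1; rewrite ?leey.
exists c => // j j0; rewrite -lee_fin; apply: (le_trans cv).
by apply: ereal_inf_lbound; exists j.
Qed.

(** If every row were within [1/(3P)] of an integer, the multiplicative form at [j] would be at most
    [J^w (3P)^(-n)], of order [q^(theta w - n)] at most, which is below [c] for large [q]. *)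
Lemma MAD_separated n m (a : 'M[R]_(n, m)) (w theta : R) : 0 < w -> 0 < theta ->
  theta * w < n%:R -> MAD w a ->
  forall eps : R, 0 < eps -> exists q0 : nat,
  forall q J P : nat, (q0 <= q)%N -> J%:R <= 3 * q%:R `^ theta ->
  eps * q%:R <= P%:R -> separated a P J.
Proof.
move=> w0 theta0 wn /MAD_bound[c c0 hc] eps eps0.
(* The factor 2 makes the final comparison strict. *)
pose B := 2 * 3 `^ w / (c * (3 * eps) ^+ n).
have [N hN] := powR_eventually B wn.
exists (maxn 1 N) => q J P; rewrite geq_max => /andP[q1 qN] hJ hP j jex jJ z.
apply: contrapT => hno.
have qR : 0 < q%:R :> R by rewrite ltr0n.
have PR : 0 < P%:R :> R by apply: lt_le_trans hP; rewrite mulr_gt0.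
have d0 : 0 < (3 * P)%:R^-1 :> R by rewrite natrM invr_gt0 mulr_gt0.
have hlt u : `|\sum_i (j i)%:~R * a u i - (z u)%:~R| <= (3 * P)%:R^-1.
  rewrite leNgt; apply/negP => h; apply: hno; exists u.
  have P3 : 0 < (3 * P)%:R :> R by rewrite -invr_gt0.
  by have h' := ltW h; rewrite -(ler_pM2l P3) mulfV ?gt_eqF // in h'.
pose jv : 'rV[int]_m := \row_i j i.
have jv0 : jv != 0.
  have [i ji] := jex; apply: contra ji => /eqP/rowP/(_ i).
  by rewrite !mxE => ->.
have := hc jv jv0; rewrite /mult_form.
have J0 : 0 <= J%:R :> R by [].
have n1 : `|map_mx intr jv : 'rV[R]_m| <= J%:R.
  apply: mx_norm_le => // i0 i; rewrite !mxE -intr_norm.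
  by rewrite -[J%:R]/(J%:Z%:~R) ler_int ltW.
have n2 : `|map_mx intr jv : 'rV[R]_m| `^ w <= J%:R `^ w.
  by apply: ge0_ler_powR; rewrite ?nnegrE // ltW.
have n3 : \prod_(u < n) dist_int (map_mx intr jv *m (row u a)^T : 'rV[R]_1) <=
    (3 * P)%:R^-1 ^+ n.
  apply: (@le_trans _ _ (\prod_(u < n) (3 * P)%:R^-1)); last by rewrite prodr_const card_ord.
  apply: ler_prod => u _; rewrite dist_int_ge0 /=.
  apply: (@dist_int_le _ _ (\row_i z u)); first exact: ltW.
  move=> i; rewrite !mxE; apply: le_trans (hlt u).
  rewrite le_eqVlt; apply/orP; left; apply/eqP; congr (`|_ - _|).
  by apply: eq_bigr => k _; rewrite !mxE.
apply/negP; rewrite -ltNge.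
have p0 : 0 <= \prod_(u < n) dist_int (map_mx intr jv *m (row u a)^T : 'rV[R]_1).
  by apply: prodr_ge0 => u _; exact: dist_int_ge0.
apply: le_lt_trans (ler_pM (powR_ge0 _ _) p0 n2 n3) _.
rewrite exprVn ltr_pdivrMr ?exprn_gt0 ?ltr0n ?muln_gt0 ?(ltr0n R) //; last first.
  by move: PR; rewrite ltr0n.
have J3 : J%:R `^ w <= 3 `^ w * q%:R `^ (theta * w).
  rewrite powRrM -powRM ?powR_ge0 //.
  by apply: ge0_ler_powR; rewrite ?nnegrE ?mulr_ge0 ?powR_ge0 // ltW.
apply: (le_lt_trans J3).
have := hN q qN; rewrite powR_mulrn // /B.
have X0 : 0 < c * (3 * eps) ^+ n by rewrite mulr_gt0 // exprn_gt0 // mulr_gt0.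
rewrite mulrAC ler_pdivrMr // => h1.
have h2 : q%:R ^+ n * (c * (3 * eps) ^+ n) <= c * (3 * P)%:R ^+ n.
  rewrite mulrCA -exprMn ler_pM2l // lerXn2r ?nnegrE ?mulr_ge0 ?(ltW eps0) //.
  by rewrite natrM mulrCA ler_pM2l // mulrC.
apply: lt_le_trans h2; apply: lt_le_trans h1.
have : 0 < 3 `^ w * q%:R `^ (theta * w) :> R by rewrite mulr_gt0 // powR_gt0.
by rewrite -mulrA; set y := _ * _; lra.
Qed.

End distances.

(** * Cauchy condensation along powers of 2 *)

Lemma dyadic_block_sum {R : realType} (f : nat -> R) (k1 K : nat) :
  (forall p q, (0 < p)%N -> (p <= q)%N -> f q <= f p) -> (k1 <= K)%N ->
  \sum_(2 ^ k1 <= q < 2 ^ K) f q <= \sum_(k1 <= k < K) 2 ^+ k * f (2 ^ k)%N.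
Proof.
move=> fdec; elim: K => [|K IH].
  by rewrite leqn0 => /eqP ->; rewrite !big_geq.
rewrite leq_eqVlt => /orP[/eqP ->|]; first by rewrite !big_geq.
rewrite ltnS => k1K; rewrite big_nat_recr //=.
rewrite (@big_cat_nat _ _ _ (2 ^ K)) /= ?leq_exp2l //.
apply: lerD; first exact: IH.
apply: (@le_trans _ _ (\sum_(2 ^ K <= q < 2 ^ K.+1) f (2 ^ K)%N)).
  rewrite big_nat [leRHS]big_nat; apply: ler_sum => q /andP[q1 _].
  by apply: fdec => //; rewrite expn_gt0.
by rewrite sumr_const_nat expnS mul2n -addnn addnK -[leLHS]mulr_natl natrX.
Qed.

Lemma geometric_sum_le {R : realType} (x : R) (k0 K : nat) : 0 <= x -> x < 1 ->
  \sum_(k0 <= k < K) x ^+ k <= (1 - x)^-1.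
Proof.
move=> x0 x1; have x1' : 0 < 1 - x by rewrite subr_gt0.
apply: (@le_trans _ _ (\sum_(0 <= k < K) x ^+ k)).
  have [k0K|Kk0] := leqP k0 K; last first.
    by rewrite big_geq ?sumr_ge0 // => *; rewrite ?exprn_ge0 // ltnW.
  rewrite [leRHS](@big_cat_nat _ _ _ k0) //= lerDr.
  by apply: sumr_ge0 => k _; rewrite exprn_ge0.
rewrite -[leRHS]mul1r ler_pdivlMr // mulrC.
have -> : (1 - x) * \sum_(0 <= k < K) x ^+ k = 1 - x ^+ K.
  elim: K => [|K IH]; first by rewrite big_geq // mulr0 expr0 subrr.
  by rewrite big_nat_recr //= mulrDr IH exprS; ring.
by rewrite lerBlDr lerDl exprn_ge0.
Qed.

(* Cauchy condensation.  As [theta d > 1], the levels [k] with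
   [psi (2^k) < 2^(- k theta)] contribute a convergent geometric series. *)
Lemma condensation {R : realType} (psi : nat -> R) (d : nat) (theta : R) :
  (forall q, (0 < q)%N -> 0 < psi q) ->
  (forall p q, (0 < p)%N -> (p <= q)%N -> psi q <= psi p) ->
  (\sum_(1 <= q <oo) (psi q ^+ d)%R%:E = +oo)%E ->
  1 < theta * d%:R -> (0 < d)%N ->
  forall (B : R) k0, exists K : nat, B <= \sum_(k0 <= k < K)
    (if (2 ^ k)%:R `^ (- theta) <= Num.min (psi (2 ^ k)%N) 1
     then 2 ^+ k * Num.min (psi (2 ^ k)%N) 1 ^+ d else 0).
Proof.
move=> psi0 psid psioo thd d0 B k0; apply: contrapT => hno.
pose g k := 2 ^+ k * Num.min (psi (2 ^ k)%N) 1 ^+ d.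
have min0 k : 0 <= Num.min (psi (2 ^ k)%N) 1.
  by rewrite le_min ler01 andbT ltW // psi0 // expn_gt0.
have g0 k : 0 <= g k by rewrite mulr_ge0 ?exprn_ge0.
pose x : R := 2 `^ (1 - theta * d%:R).
have x0 : 0 <= x by exact: powR_ge0.
have x1 : x < 1.
  have s0 : 0 < theta * d%:R - 1 by rewrite subr_gt0.
  rewrite /x -opprB powRN invf_lt1 ?powR_gt0 //.
  have := @gt0_ltr_powR R _ s0 1 2; rewrite powR1 !nnegrE; apply => //.
  by rewrite ltr1n.
have hB K : \sum_(k0 <= k < K) g k <= `|B| + (1 - x)^-1.
  have hK : \sum_(k0 <= k < K)
    (if (2 ^ k)%:R `^ (- theta) <= Num.min (psi (2 ^ k)%N) 1 then g k else 0) <= `|B|.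
    apply: le_trans (ler_norm B); rewrite leNgt; apply/negP => h.
    by apply: hno; exists K; exact: ltW.
  apply: le_trans (lerD hK (geometric_sum_le k0 K x0 x1)).
  rewrite -big_split /=; apply: ler_sum => k _; case: ifPn => [_|].
    by rewrite lerDl exprn_ge0.
  rewrite -ltNge add0r => /ltW h; rewrite /g.
  have -> : x ^+ k = 2 ^+ k * ((2 ^ k)%:R `^ (- theta)) ^+ d.
    rewrite /x -powR_mulrn ?powR_ge0 // -powRrM natrX -[2 ^+ k]powR_mulrn //.
    rewrite -powRrM -[(_ `^ _) ^+ d]powR_mulrn ?powR_ge0 // -powRrM -powRD; last first.
      by rewrite pnatr_eq0 implybT.
    by congr (_ `^ _); ring.
  by rewrite ler_wpM2l ?exprn_ge0 // lerXn2r ?nnegrE ?powR_ge0.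
set B' := `|B| + _ in hB.
pose k1 := maxn k0 (Num.truncn B').+1.
(* From [k1] on the minimum with 1 is [psi] itself: otherwise the single term [g k = 2^k] would
   exceed the bound [B']. *)
have psi1 k : (k1 <= k)%N -> Num.min (psi (2 ^ k)%N) 1 = psi (2 ^ k)%N.
  move=> kk; apply/min_idPl; rewrite leNgt; apply/negP => h.
  have : g k <= B'.
    apply: le_trans (hB k.+1); rewrite big_nat_recr /=; last first.
      by apply: leq_trans kk; exact: leq_maxl.
    by rewrite lerDr sumr_ge0.
  rewrite /g (min_idPr (ltW h)) expr1n mulr1; apply/negP; rewrite -ltNge.
  apply: lt_le_trans (truncnS_gt B') _; rewrite -natrX ler_nat.
  apply: leq_trans (ltnW (ltn_expl k (isT : (1 < 2)%N))).
  by apply: leq_trans kk; exact: leq_maxr.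
pose M := \sum_(1 <= q < 2 ^ k1) psi q ^+ d + B'.
have hM N : \sum_(1 <= q < N) psi q ^+ d <= M.
  pose K := maxn k1 N.
  have NK : (N <= 2 ^ K)%N.
    by apply: leq_trans (ltnW (ltn_expl K (isT : (1 < 2)%N))); exact: leq_maxr.
  apply: (@le_trans _ _ (\sum_(1 <= q < 2 ^ K) psi q ^+ d)).
    have [N1|N1] := leqP 1 N; last first.
      rewrite big_geq; last exact: ltnW.
      rewrite big_nat; apply: sumr_ge0 => q /andP[q1 _].
      by apply: exprn_ge0; apply/ltW/psi0.
    rewrite [leRHS](big_cat_nat N1 NK) /= lerDl big_nat.
    apply: sumr_ge0 => q /andP[q1 _]; apply: exprn_ge0; apply/ltW/psi0.
    exact: leq_trans q1.
  have k1K : (2 ^ k1 <= 2 ^ K)%N by rewrite leq_exp2l // leq_maxl.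
  have k10 : (0 < 2 ^ k1)%N by rewrite expn_gt0.
  rewrite (big_cat_nat k10 k1K) /=.
  rewrite lerD2l.
  apply: le_trans (@dyadic_block_sum R (fun q => psi q ^+ d) k1 K _ (leq_maxl _ _)) _.
    move=> p q p0 pq; rewrite lerXn2r ?nnegrE ?psid // ltW // psi0 //.
    exact: leq_trans pq.
  apply: le_trans (hB K).
  rewrite (eq_big_nat _ _ (F2 := g)); last first.
    by move=> k /andP[kk _]; rewrite /g psi1.
  rewrite [leRHS](@big_cat_nat _ _ _ k1) //= ?leq_maxl //.
  by rewrite lerDr sumr_ge0.
have : (\sum_(1 <= q <oo) (psi q ^+ d)%R%:E <= M%:E)%E.
  apply: lime_le.
    apply: is_cvg_nneseries => q q1 _; rewrite lee_fin exprn_ge0 // ltW // psi0 //.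
  by apply: nearW => N; rewrite sumEFin lee_fin.
by rewrite psioo leye_eq.
Qed.

(** * Boxes of well approximable parameters fill every cell *)

Section approximating_boxes.
Context {R : realType} (n m : nat) (a : 'M[R]_(n, m)) (a0 : 'I_m -> R).
Variable psi : nat -> R.
Hypotheses (psi0 : forall q, (0 < q)%N -> 0 < psi q) (psi1 : forall q, psi q <= 1).
Hypothesis psid : forall p q, (0 < p)%N -> (p <= q)%N -> psi q <= psi p.
Local Notation tup := (n.-tuple (measurableTypeR R)).
Local Notation mu := (@lebesgue_measure_n R n).

(** Bounds the sup-norm Lipschitz constant of [x -> x a]; the added 1 lets division by it serve the
    first [n] coordinates as well. *)
Definition slope : R := 1 + \sum_u \sum_i `|a u i|.

Definition radius (q : nat) : R := psi q / (4 * slope * q%:R).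

Definition near_integral (q : nat) (p : {ffun 'I_n -> int}) := exists z : 'I_m -> int,
  forall i, `|\sum_u (p u)%:~R * a u i + q%:R * a0 i - (z i)%:~R| <= psi q / 4.

Definition approx_boxes (K : nat) : set tup :=
  \bigcup_(x in [set x : nat * {ffun 'I_n -> int} |
      [/\ (K <= x.1)%N, (0 < x.1)%N & near_integral x.1 x.2]])
    box (fun u => (x.2 u)%:~R / x.1%:R) (radius x.1).

Lemma slope_ge1 : 1 <= slope.
Proof. by rewrite lerDl; apply: sumr_ge0 => u _; apply: sumr_ge0. Qed.

Let slope_gt0 : 0 < slope. Proof. exact: lt_le_trans slope_ge1. Qed.

Lemma measurable_approx_boxes K : measurable (approx_boxes K).
Proof.
pose C := [set x : nat * {ffun 'I_n -> int} |
      [/\ (K <= x.1)%N, (0 < x.1)%N & near_integral x.1 x.2]].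
pose B (x : nat * {ffun 'I_n -> int}) :=
  box (fun u => (x.2 u)%:~R / x.1%:R) (radius x.1).
have -> : approx_boxes K = \bigcup_i (\bigcup_(x in [set x | C x /\ pickle x = i]) B x).
  apply/seteqP; split => [t [x Cx Bt]|t [i _ [x [Cx _] Bt]]]; last by exists x.
  by exists (pickle x) => //; exists x.
apply: bigcup_measurable => i _.
have [[x [Cx xi]]|h] := pselect (exists x, C x /\ pickle x = i).
  have -> : \bigcup_(x in [set x | C x /\ pickle x = i]) B x = B x.
    apply/seteqP; split => [t [y [Cy yi]]|t Bt]; last by exists x.
    by have -> : y = x by apply: (pcan_inj pickleK); rewrite yi.
  exact: measurable_box.
rewrite (_ : \bigcup_(x in _) _ = set0); first exact: measurable0.
by apply/seteqP; split => // t [x Cx _]; apply: h; exists x.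
Qed.

(** An error of [psi q / (4 slope)] in [q x] moves [q x a] by at most [psi q / 4]; together with the
    [psi q / 4] of [near_integral] this makes [psi q / 2], strictly below the target. *)
Lemma approx_boxesP K t : approx_boxes K t -> exists (q : nat) (p : 'I_n -> int) (z : 'I_m -> int),
  [/\ (K <= q)%N, (0 < q)%N, (forall u, `|q%:R * tnth t u - (p u)%:~R| <= psi q / 2) &
  forall i, `|\sum_u q%:R * tnth t u * a u i + q%:R * a0 i - (z i)%:~R| <= psi q / 2].
Proof.
move=> [[q p] /= [Kq q0 [z hz]] ht]; exists q, p, z.
have qR : 0 < q%:R :> R by rewrite ltr0n.
have p0 := psi0 q0; have s1 := slope_ge1.
have hq u : `|q%:R * tnth t u - (p u)%:~R| <= psi q / (4 * slope).
  have := ht u; rewrite -(ler_pM2l qR) -{1}(ger0_norm (ltW qR)) -normrM.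
  rewrite mulrBr mulrCA mulfV ?gt_eqF // mulr1 => /le_trans; apply.
  by rewrite /radius le_eqVlt; apply/orP; left; apply/eqP; field; rewrite !gt_eqF.
have b4 : psi q / (4 * slope) <= psi q / 4.
  by rewrite ler_pM2l // lef_pV2 ?posrE ?mulr_gt0 // ler_peMr.
split=> // [u|i].
  by apply: le_trans (hq u) (le_trans b4 _); lra.
have -> : \sum_u q%:R * tnth t u * a u i + q%:R * a0 i - (z i)%:~R =
    (\sum_u (p u)%:~R * a u i + q%:R * a0 i - (z i)%:~R) +
    \sum_u (q%:R * tnth t u - (p u)%:~R) * a u i.
  have -> : \sum_u q%:R * tnth t u * a u i = \sum_u (p u)%:~R * a u i +
      \sum_u (q%:R * tnth t u - (p u)%:~R) * a u i.
    by rewrite -big_split /=; apply: eq_bigr => u _; ring.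
  ring.
apply: le_trans (ler_normD _ _) _.
have -> : psi q / 2 = psi q / 4 + psi q / 4 by field.
apply: lerD (hz i) _; apply: le_trans (ler_norm_sum _ _ _) _.
apply: (@le_trans _ _ (psi q / (4 * slope) * slope)); last first.
  by rewrite le_eqVlt; apply/orP; left; apply/eqP; field; rewrite gt_eqF.
apply: (@le_trans _ _ (psi q / (4 * slope) * \sum_u `|a u i|)).
  by rewrite mulr_sumr; apply: ler_sum => u _; rewrite normrM ler_wpM2r.
rewrite ler_wpM2l ?divr_ge0 ?mulr_ge0 ?(ltW p0) ?(ltW slope_gt0) //.
rewrite /slope; apply: ler_wpDl => //; apply: ler_sum => u _.
by rewrite (bigD1 i) //= lerDl sumr_ge0.
Qed.

Variable theta : R.
Hypotheses (n0 : (0 < n)%N) (m0 : (0 < m)%N) (theta0 : 0 < theta)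
  (thetam : theta * m%:R < 1).
Hypothesis sep : forall eps : R, 0 < eps -> exists q0 : nat,
  forall q J P : nat, (q0 <= q)%N -> J%:R <= 3 * q%:R `^ theta ->
  eps * q%:R <= P%:R -> separated a P J.
Hypothesis diverge : forall (B : R) k0, exists K : nat, B <= \sum_(k0 <= k < K)
    (if (2 ^ k)%:R `^ (- theta) <= psi (2 ^ k)%N
     then 2 ^+ k * psi (2 ^ k)%N ^+ (n + m) else 0).

(** The proportion [1/w] depends only on [n] and the [c1] of [good_points], not on the cell. At
    level [k] all boxes get the radius belonging to [2^k]; since the actual denominators satisfy
    [q <= 2^k] and [psi] decreases, this is at most [radius q], so the boxes lie in
    [approx_boxes K0]. *)
Lemma approx_boxes_dense : exists c : R, [/\ 0 < c, c <= 1 & forall K0 N z,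
  (c%:E * mu (cell N z) <= mu (approx_boxes K0 `&` cell N z))%E].
Proof.
have [E0 [c1 [c2 [E00 c10 c20 hgp]]]] :=
  @good_points R n m a a0 theta n0 m0 theta0 thetam sep.
pose w := 4 ^+ n / c1 + 4 * 6 ^+ n.
have w1 : 1 <= w.
  apply: ler_wpDl; first by rewrite divr_ge0 ?exprn_ge0 // ltW.
  have : 1 <= 6 ^+ n :> R by rewrite exprn_ege1 // ler1n.
  lra.
have w0 : 0 < w by apply: lt_le_trans w1.
exists w^-1; split; [by rewrite invr_gt0|by rewrite invf_le1|].
move=> K0 N z; set h : R := 2 ^- N.
have h0 : 0 < h by rewrite invr_gt0 exprn_gt0.
have [Q0 hQ] := hgp h h0.
pose o u : R := (z u)%:~R / 2 ^+ N.
(* The summands secure [2^k >= Q0], denominators [q > 2^k / E0 >= K0], and [2^k >= 8 * 2^N], which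
   puts the radius below [h/8] and so the box inside the cell. *)
pose k0 := (Q0 + E0 * K0 + N + 3)%N.
pose used k := (k0 <= k)%N && ((2 ^ k)%:R `^ (- theta) <= psi (2 ^ k)%N).
(* Large enough for [1/(8 m J)] to be below [psi/4]; rounding up costs at most [1 <= 1/psi], hence
   [J <= 3/psi]. *)
pose J k := (Num.truncn (2 / psi (2 ^ k)%N)).+1.
have pw k : (0 < 2 ^ k)%N by rewrite expn_gt0.
have p0 k := psi0 (pw k).
have pwR k : 0 < (2 ^ k)%:R :> R by rewrite ltr0n.
have J1 k : 2 / psi (2 ^ k)%N <= (J k)%:R by apply/ltW/truncnS_gt.
have J3 k : (J k)%:R <= 3 / psi (2 ^ k)%N.
  have p2 : 0 <= 2 / psi (2 ^ k)%N by rewrite divr_ge0 // ltW.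
  have /andP[t1 _] := truncn_itv p2.
  have -> : 3 / psi (2 ^ k)%N = 2 / psi (2 ^ k)%N + 1 / psi (2 ^ k)%N by ring.
  rewrite /J -natr1; apply: lerD => //.
  by rewrite ler_pdivlMr // mul1r.
have hk k : exists sX : R * seq {ffun 'I_n -> R}, [/\ 0 < sX.1,
    (forall x, x \in sX.2 -> (forall u, o u + h / 8 <= x u <= o u + 7 * h / 8) /\
      exists (q : nat) (p : 'I_n -> int) (z : 'I_m -> int),
      [/\ (0 < q <= 2 ^ k)%N, (2 ^ k < q * E0)%N, (forall u, x u = (p u)%:~R / q%:R) &
       forall i, (8 * m * J k)%:R *
         `|\sum_u (p u)%:~R * a u i + q%:R * a0 i - (z i)%:~R| < 1]),
    (forall (y : 'I_n -> R) rho, 0 <= rho ->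
      (count (fun x : {ffun 'I_n -> R} => [forall u, `|x u - y u| <= rho]) sX.2)%:R
        <= (2 * rho / sX.1 + 3) ^+ n) &
    if used k then c1 * h ^+ n <= (size sX.2)%:R * sX.1 ^+ n /\
      c2 * (2 ^ k)%:R ^+ n.+1 / (J k)%:R ^+ m <= sX.1 ^- n else sX.2 = [::]].
  case: (boolP (used k)) => [/andP[kk hp]|_]; last first.
    exists (1, [::]); split=> //= y rho rho0.
    by rewrite exprn_ge0 // divr1 addr_ge0 // mulr_ge0.
  have Qk : (Q0 <= 2 ^ k)%N.
    apply: leq_trans (ltnW (ltn_expl k (isT : (1 < 2)%N))).
    by apply: leq_trans kk; rewrite /k0 -!addnA leq_addr.
  have JQ : (J k)%:R <= 3 * (2 ^ k)%:R `^ theta.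
    apply: le_trans (J3 k) _; rewrite ler_pM2l //.
    by rewrite -[leRHS]invrK -powRN lef_pV2 ?posrE // powR_gt0.
  have [s [X [s0 hX hsz hc hd]]] := hQ o (2 ^ k)%N (J k) Qk isT JQ.
  by exists (s, X); split.
have [F hF] := choice hk.
pose X k := (F k).2; pose s k := (F k).1.
have r0 k : 0 < radius (2 ^ k)%N by rewrite divr_gt0 // !mulr_gt0.
have s0 k : 0 < s k by case: (hF k).
have r_half k l : (k <= l)%N ->
    radius (2 ^ l)%N <= radius (2 ^ k)%N * 2 ^- (l - k).
  move=> kl.
  have e : (2 ^ l)%:R = (2 ^ k)%:R * 2 ^+ (l - k) :> R.
    by rewrite -natrX -natrM -expnD subnKC.
  have e2 : 0 < 2 ^+ (l - k) :> R by rewrite exprn_gt0.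
  rewrite /radius e.
  rewrite [leRHS](_ : _ = psi (2 ^ k)%N / (4 * slope * ((2 ^ k)%:R * 2 ^+ (l - k)))).
    rewrite ler_pM2r; last by rewrite invr_gt0 mulr_gt0 // mulr_gt0.
    by apply: psid => //; rewrite leq_exp2l.
  by field; rewrite !gt_eqF.
have X_near k : forall (y : 'I_n -> R) rho, 0 <= rho ->
    (count (fun x : {ffun 'I_n -> R} => [forall u, `|x u - y u| <= rho]) (X k))%:R
    <= (2 * rho / s k + 3) ^+ n by case: (hF k).
have X_size k : X k != [::] -> c1 * h ^+ n <= (size (X k))%:R * s k ^+ n.
  by rewrite /X /s; case: (hF k) => _ _ _; case: ifPn => _ => [[]//|->].
set E := approx_boxes K0 `&` cell N z.
have mE : measurable E.
  by apply: measurableI; [exact: measurable_approx_boxes|exact: measurable_cell].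
have Eoo : (mu E < +oo)%E.
  apply: (@le_lt_trans _ _ (mu (cell N z))); last by rewrite lebesgue_cell ltry.
  by apply: le_measure; rewrite ?inE; [exact: mE|exact: measurable_cell|exact: subIsetr].
have XE k x : x \in X k -> box x (radius (2 ^ k)%N) `<=` E.
  have [_ hX _ hu] := hF k; move=> xX.
  have uk : used k.
    by move: hu; case: ifPn => // _ X0; move: xX; rewrite /X X0.
  have /andP[kk _] := uk.
  have [hx [q [p [z' [/andP[q0 qk] qE hxp hz]]]]] := hX x xX.
  have qR : 0 < q%:R :> R by rewrite ltr0n.
  have r8 : radius (2 ^ k)%N < h / 8.
    rewrite /radius ltr_pdivrMr ?mulr_gt0 //.
    have hk8 : 1 <= h / 8 * (2 ^ k)%:R.
      rewrite /h natrX -(subnKC (_ : (N + 3 <= k)%N)); last first.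
        by apply: leq_trans kk; rewrite /k0 -addnA leq_addl.
      rewrite exprD exprD.
      have e2 : 1 <= 2 ^+ (k - (N + 3)) :> R by rewrite exprn_ege1 // ler1n.
      have e3 : 0 < 2 ^+ N :> R by rewrite exprn_gt0.
      rewrite [leRHS](_ : _ = 2 ^+ (k - (N + 3))) //; field; by rewrite gt_eqF.
    apply: (@le_lt_trans _ _ 1) => //.
    rewrite (_ : h / 8 * (4 * slope * _) = 4 * slope * (h / 8 * (2 ^ k)%:R)); last by ring.
    have s1 := slope_ge1; set v := h / 8 * _ in hk8 *; clearbody v.
    by move: slope s1 => S s1; nra.
  move=> t ht; split; last first.
    rewrite cellE /= => u; rewrite in_itv /=.
    have := ht u; rewrite ler_distl => /andP[t1 t2]; have /andP[x1 x2] := hx u.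
    have -> : ((z u)%:~R + 1) / 2 ^+ N = o u + h by rewrite mulrDl mul1r.
    rewrite -/(o u); apply/andP; split; lra.
  exists (q, [ffun u => p u]) => /=.
    split=> //.
      have : (E0 * K0 < q * E0)%N.
        apply: leq_ltn_trans qE; apply: leq_trans (ltnW (ltn_expl k (isT : (1 < 2)%N))).
        by apply: leq_trans kk; rewrite /k0 -addnA -addnA addnCA leq_addr.
      by rewrite mulnC ltn_pmul2r // => /ltnW.
    exists z' => i; under eq_bigr => u _ do rewrite ffunE.
    have := ltW (hz i); set y := `|_| => hy.
    have y0 : 0 <= y by exact: normr_ge0.
    have p4 : psi (2 ^ k)%N <= psi q by exact: psid.
    apply: le_trans (_ : psi (2 ^ k)%N / 4 <= _); last by rewrite ler_pM2r.
    have h8 : 8 * (J k)%:R * y <= 1.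
      apply: le_trans hy; rewrite ler_wpM2r // !natrM ler_wpM2r //.
      by rewrite ler_peMr // ler1n.
    have h2 : 2 <= (J k)%:R * psi (2 ^ k)%N by rewrite -ler_pdivrMr.
    have := ler_wpM2r y0 h2; have := ler_wpM2l (ltW (p0 k)) h8.
    move: (psi (2 ^ k)%N) (p0 k) => P Pp; move: ((J k)%:R : R) => JJ; clearbody y.
    lra.
  move=> u; rewrite ffunE -hxp; apply: le_trans (ht u) _.
  rewrite /radius; apply: ler_pM.
  { exact: ltW. }
  { by rewrite invr_ge0 mulr_ge0 // mulr_ge0 // ltW. }
  { exact: psid. }
  by rewrite lef_pV2 ?posrE ?mulr_gt0 // ler_pM2l ?mulr_gt0 // ler_nat.
(* With [Q = 2^k], a used level has at least [c1 h^n s^(-n)] points, where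
   [s^(-n) >= c2 Q^(n+1) / J^m] and [J <= 3/psi]; times the volume [(psi / (2 slope Q))^n] of a box
   this is at least [A Q psi^(n+m)]. *)
pose A : R := c1 * c2 * h ^+ n / ((2 * slope) ^+ n * 3 ^+ m).
have hn0 : 0 < h ^+ n by rewrite exprn_gt0.
have A0 : 0 < A.
  by rewrite divr_gt0 ?mulr_gt0 ?exprn_gt0 // mulr_gt0.
have [K hK] := diverge (h ^+ n / A) k0.
have hS : h ^+ n <= \sum_(0 <= k < K) (size (X k))%:R * (2 * radius (2 ^ k)%N) ^+ n.
  have T0 k : 0 <= (size (X k))%:R * (2 * radius (2 ^ k)%N) ^+ n.
    by rewrite mulr_ge0 // exprn_ge0 // mulr_ge0 // ltW.
  apply: (@le_trans _ _ (\sum_(k0 <= k < K)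
    (size (X k))%:R * (2 * radius (2 ^ k)%N) ^+ n)); last first.
    have [kK|Kk] := leqP k0 K; last by rewrite big_geq ?sumr_ge0 // ltnW.
    by rewrite [leRHS](big_cat_nat (leq0n k0) kK) /= lerDr sumr_ge0.
  have : h ^+ n = A * (h ^+ n / A) by rewrite mulrCA mulfV ?mulr1 // gt_eqF.
  move=> ->; apply: le_trans (ler_wpM2l (ltW A0) hK) _.
  rewrite mulr_sumr big_nat [leRHS]big_nat; apply: ler_sum => k /andP[kk _].
  case: ifPn => hp; last by rewrite mulr0.
  have uk : used k by rewrite /used kk.
  have [_ _ _] := hF k; rewrite uk -/(X k) -/(s k) => -[d1 d2].
  set P := psi (2 ^ k)%N; set Q : R := (2 ^ k)%:R.
  have P0 : 0 < P by exact: p0.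
  have Q0' : 0 < Q by exact: pwR.
  have JP : 0 < (J k)%:R ^+ m :> R by rewrite exprn_gt0 // ltr0n.
  have rE : (2 * radius (2 ^ k)%N) ^+ n = P ^+ n / ((2 * slope) ^+ n * Q ^+ n).
    rewrite -exprMn -expr_div_n /radius; congr (_ ^+ n).
    by rewrite -/P -/Q; field; rewrite !gt_eqF.
  have sn : 0 < s k ^+ n by rewrite exprn_gt0.
  have d1' : c1 * h ^+ n * s k ^- n <= (size (X k))%:R by rewrite ler_pdivrMr.
  have Jm : P ^+ m / 3 ^+ m <= (J k)%:R ^- m.
    rewrite -expr_div_n -exprVn lerXn2r ?nnegrE ?invr_ge0 ?divr_ge0 ?(ltW P0) //.
    rewrite -[leLHS]invrK lef_pV2 ?posrE ?invr_gt0 ?divr_gt0 ?ltr0n //.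
    by rewrite invf_div; exact: J3.
  rewrite rE; set S2 := (2 * slope) ^+ n.
  have S20 : 0 < S2 by rewrite exprn_gt0 // mulr_gt0.
  have Qn : 0 < Q ^+ n by rewrite exprn_gt0.
  have Pn : 0 < P ^+ n by rewrite exprn_gt0.
  have f0 : 0 <= P ^+ n / (S2 * Q ^+ n) by rewrite divr_ge0 ?mulr_ge0 // ltW.
  apply: le_trans (ler_wpM2r f0 d1').
  have g0 : 0 <= c1 * h ^+ n by rewrite mulr_ge0 // ltW.
  apply: le_trans (ler_wpM2r f0 (ler_wpM2l g0 d2)).
  have e0 : 0 <= c1 * h ^+ n * (c2 * Q ^+ n.+1) * (P ^+ n / (S2 * Q ^+ n)).
    by apply: mulr_ge0 => //; apply: mulr_ge0 => //; apply: mulr_ge0; rewrite ?exprn_ge0 // ltW.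
  apply: le_trans (_ : c1 * h ^+ n * (c2 * Q ^+ n.+1) *
    (P ^+ n / (S2 * Q ^+ n)) * (P ^+ m / 3 ^+ m) <= _).
    rewrite le_eqVlt; apply/orP; left; apply/eqP.
    have t3 : 0 < 3 ^+ m :> R by rewrite exprn_gt0.
    have alg (x y z' u v t q qn s2 : R) : 0 < qn -> 0 < s2 -> 0 < t ->
        x * y * z' / (s2 * t) * (q * (u * v)) =
        x * z' * (y * (q * qn)) * (u / (s2 * qn)) * (v / t).
      by move=> *; field; rewrite !gt_eqF.
    have Qk : 2 ^+ k = Q by rewrite /Q natrX.
    by rewrite Qk exprD exprS; exact: alg.
  have := ler_wpM2l e0 Jm; set e := c1 * h ^+ n * _ * _ => he.
  apply: le_trans he _; rewrite le_eqVlt; apply/orP; left; apply/eqP.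
  by rewrite /e -/Q; ring.
have := @measure_levels R n h c1 K X (fun k => radius (2 ^ k)%N) s E
  h0 c10 n0 r0 s0 r_half X_near X_size mE Eoo XE hS.
rewrite -/w lebesgue_cell -/h -EFinM => hm.
have -> : mu E = (fine (mu E))%:E by rewrite fineK // ge0_fin_numE.
by rewrite lee_fin mulrC.
Qed.

Lemma approx_boxes_full : mu.-negligible (\bigcup_K ~` approx_boxes K).
Proof.
have [c [c0 c1 hc]] := approx_boxes_dense.
apply: negligible_bigcup => K.
exact: (density_negligible (measurable_approx_boxes K) c0 c1 (hc K)).
Qed.

End approximating_boxes.

(** * Transfer to the points of the affine subspace *)

Lemma dist_int_castmx {R : realType} k k' (e : k = k') (q : R) (y : 'rV[R]_k) :
  dist_int (q *: castmx (erefl, e) y) = dist_int (q *: y).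
Proof. by case: k' / e; rewrite castmx_id. Qed.


Theorem theorem1 (R : realType) (n d : nat) (n_gt0 : (1 <= n)%N)
    (lt_nd : (n < d)%N) (a : 'M[R]_(n, d - n)) (a0 : 'rV[R]_(d - n)) :
  (mult_exponent a < (d * n)%:R%:E)%E ->
  khintchine_type_divergence (ltnW lt_nd) a a0.
Proof.
move=> /ereal_inf_lt[_ [w [w0 MADw] <-]]; rewrite lte_fin => wdn.
move=> psi psi0 psid psioo.
have m0 : (0 < d - n)%N by rewrite subn_gt0.
have d0 : (0 < d)%N by apply: leq_ltn_trans lt_nd.
have dR : 0 < d%:R :> R by rewrite ltr0n.
have mR : 0 < (d - n)%:R :> R by rewrite ltr0n.
have nR : 0 < n%:R :> R by rewrite ltr0n.
(* The midpoint of [1/d] and [min(n/w, 1/(d-n))]; the interval is nonempty because [w < d n] and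
   [n >= 1]. *)
have [theta [theta1 thetaw thetam]] : exists theta : R,
    [/\ 1 < theta * d%:R, theta * w < n%:R & theta * (d - n)%:R < 1].
  pose hi := Num.min (n%:R / w) (d - n)%:R^-1.
  have lohi : d%:R^-1 < hi.
    rewrite lt_min; apply/andP; split.
      by rewrite ltr_pdivlMr // mulrC ltr_pdivrMr // mulrC -natrM.
    by rewrite ltf_pV2 ?posrE // ltr_nat ltn_subLR ?(ltnW lt_nd) // -[ltnLHS]add0n ltn_add2r.
  have [l1 l2] := midf_lt lohi.
  exists ((d%:R^-1 + hi) / 2); split.
  { by rewrite -ltr_pdivrMr // div1r. }
  { by rewrite -ltr_pdivlMr //; apply: lt_le_trans l2 _; rewrite ge_min lexx. }
  rewrite -ltr_pdivlMr // div1r; apply: lt_le_trans l2 _.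
  by rewrite ge_min lexx orbT.
have theta0 : 0 < theta.
  by rewrite -(pmulr_lgt0 _ dR); apply: lt_trans theta1.
(* Truncation at 1 only strengthens the approximation demanded, and [condensation] gives divergence
   for the truncated function directly. *)
pose phi q := Num.min (psi q) 1.
have phi0 q : (0 < q)%N -> 0 < phi q by move=> q0; rewrite lt_min psi0 /=.
have phi1 q : phi q <= 1 by rewrite ge_min lexx orbT.
have phid p q : (0 < p)%N -> (p <= q)%N -> phi q <= phi p.
  by move=> p0 pq; rewrite le_min !ge_min psid // lexx orbT.
have diverge := condensation psi0 psid psioo theta1 d0.
rewrite -(subnKC (ltnW lt_nd)) in diverge.
have := approx_boxes_full (fun i => a0 0 i) phi0 phi1 phid n_gt0 m0 theta0 thetam
  (MAD_separated w0 theta0 thetaw MADw) diverge.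
apply: negligibleS => t /= [_ napp]; apply: contrapT => hE; apply: napp.
move=> /finite_seqP[s hs].
(* A box whose denominator exceeds every element of [s] yields a solution [q] outside [s]. *)
pose K := (\max_(q <- s) q).+1.
have : approx_boxes a (fun i => a0 0 i) phi K t.
  by apply: contrapT => hK; apply: hE; exists K.
move=> /(approx_boxesP phi0)[q [p [z [Kq q0 hp hz]]]].
have qs : q \in s.
  have : [set` s] q; last by [].
  rewrite -hs /=; split=> //.
  have phiq := phi0 q q0.
  rewrite /graph_point dist_int_castmx.
  apply: (@le_lt_trans _ _ (phi q / 2)); last first.
    have : phi q <= psi q by rewrite ge_min lexx.
    by rewrite ltr_pdivrMr //; lra.
  apply: (@dist_int_le _ _ _ (row_mx (\row_u p u) (\row_i z i))).
    by rewrite divr_ge0 // ltW.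
  move=> i; rewrite !mxE; case: (fintype.split i) => j; rewrite !mxE; first exact: hp.
  rewrite mulrDr mulr_sumr; apply: le_trans (hz j).
  rewrite le_eqVlt; apply/orP; left; apply/eqP; congr (`|_ + _ - _|).
  by apply: eq_bigr => u _; rewrite mxE mulrA.
have := @leq_bigmax_seq _ s xpredT id q qs isT.
by rewrite leqNgt => /negP; apply.
Qed.
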